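(* Let $p$ be a prime and let $k$ be a field of characteristic $p$. Let $\Delta$ be a connected simplicial pseudomanifold of dimension $d-1$ that is oriented over $k$, with vertex set $\{1,\dots,n\}$. Let $\overline{H}(\Delta)$ be the Gorenstein quotient of the generic artinian reduction of the Stanley–Reisner ring of $\Delta$ over $K=k(a_{i,j})_{1\le i\le d,\,1\le j\le n}$, and let $\ell=x_1+\dots+x_n\in\overline{H}^1(\Delta)$. Then: (i) if $g\in\overline{H}^m(\Delta)$ is nonzero for some $m\le d/p$, then $g^p$ is nonzero; (ii) for every $m\le d/p$, the map $\overline{H}^m(\Delta)\to\overline{H}^{d-(p-1)m}(\Delta)$ given by multiplication by $\ell^{d-pm}$ is injective; (iii) for every $m\le\frac{d-1}{p}$, the map $\overline{H}^m(\Delta)\to\overline{H}^{m+1}(\Delta)$ given by multiplication by $\ell$ is injective; (iv) $\dim_K\overline{H}^0(\Delta)\le\dots\le\dim_K\overline{H}^{\lfloor (d-1)/p\rfloor}(\Delta)$.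
   Context: A simplicial pseudomanifold of dimension $d-1$ is a pure simplicial complex $\Delta$ of dimension $d-1$ such that every $(d-2)$-dimensional face lies in exactly two facets, and each connected component of the geometric realization of $\Delta$ remains connected after removing its $(d-3)$-skeleton. ''Oriented over $k$'' means that an orientation over $k$ is fixed: each facet $F=\{j_1<\dots<j_d\}$ is given an ordering of its vertices up to even permutation, recorded by the sign $\epsilon_F\in\{1,-1\}$ of the permutation taking $(j_1,\dots,j_d)$ to this ordering, such that $\sum_F \epsilon_F\,[j_1,\dots,j_d]$ is a simplicial cycle with coefficients in $k$. $K=k(a_{i,j})_{1\le i\le d,\,1\le j\le n}$ is the field of rational functions in the variables $a_{i,j}$; $K[\Delta]$ is the Stanley–Reisner ring of $\Delta$ over $K$ (the quotient of $K[x_1,\dots,x_n]$ by the squarefree monomials of non-faces); $\mu_i=\sum_j a_{i,j}x_j$ for $1\le i\le d$; $H(\Delta)=K[\Delta]/(\mu_1,\dots,\mu_d)$ is the generic artinian reduction, a graded ring. $H^d(\Delta)$ is $1$-dimensional over $K$ and is spanned by the monomial $x^F=\prod_{j\in F}x_j$ of any facet $F$. The degree map $\deg\colon H^d(\Delta)\to K$ is the $K$-linear isomorphism determined by $\deg(x^F)=\epsilon_F/[F]$ for every facet $F=\{j_1<\dots<j_d\}$, where $[F]$ is the determinant of the $d\times d$ matrix with $(i,m)$ entry $a_{i,j_m}$. The Gorenstein quotient $\overline{H}(\Delta)$ is the graded quotient ring of $H(\Delta)$ by the kernel of the pairing $H^{\bullet}(\Delta)\times H^{d-\bullet}(\Delta)\to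 K$, $(g,h)\mapsto\deg(g\cdot h)$. *)

(* Defs.v *)
From HB Require Import structures.
From mathcomp Require Import all_boot all_order all_algebra.
From mathcomp Require Import generic_quotient ring_quotient fraction.
From mathcomp Require Import mpoly.
From mathcomp Require Import boolp classical_sets reals topology.

Set Implicit Arguments.
Unset Strict Implicit.
Unset Printing Implicit Defensive.

Import GRing.Theory numFieldTopology.Exports.
Local Open Scope ring_scope.
Local Open Scope quotient_scope.

Section IdealQuotientAlgebra.
Variables (F : fieldType) (A : comAlgType F) (I : idealr A).
Local Notation Q := {ideal_quot I}.

Definition qscale (c : F) (u : Q) : Q := \pi_Q (c *: repr u).

Lemma pi_qscale c a : \pi_Q (c *: a) = qscale c (\pi_Q a).
Proof.
have cI x : x \in I -> c *: x \in I.
  by rewrite -mulr_algl => xI; apply: (idealMr (idealrI := I)).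
rewrite /qscale; apply/eqP; rewrite -Quotient.idealrBE -scalerBr.
have := Quotient.idealrBE I a (repr (\pi_Q a)).
rewrite reprK eqxx; exact: cI.
Qed.

Fact qscaleA c e u : qscale c (qscale e u) = qscale (c * e) u.
Proof.
elim/quotW: u => a.
by rewrite -(pi_qscale e a) -(pi_qscale c (e *: a)) -(pi_qscale (c * e) a) scalerA.
Qed.
Fact qscale1 : left_id 1 qscale.
Proof. by elim/quotW => a; rewrite -(pi_qscale 1 a) scale1r. Qed.
Fact qscaleDr : right_distributive qscale +%R.
Proof.
move=> c; elim/quotW => a; elim/quotW => b.
rewrite -[_ + _](raddfD (\pi_Q) a b) -(pi_qscale c a) -(pi_qscale c b).
by rewrite -(pi_qscale c (a + b)) scalerDr raddfD.
Qed.
Fact qscaleDl u : {morph qscale^~ u : c e / c + e}.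
Proof.
move=> c e; elim/quotW: u => a.
by rewrite -(pi_qscale c a) -(pi_qscale e a) -(pi_qscale (c + e) a) scalerDl raddfD.
Qed.

HB.instance Definition _ := GRing.Zmodule_isLmodule.Build F Q
  qscaleA qscale1 qscaleDr qscaleDl.

Fact qscaleAl (c : F) (u v : Q) : c *: (u * v) = (c *: u) * v.
Proof.
elim/quotW: u => a; elim/quotW: v => b.
rewrite -[X in _ *: X](rmorphM (\pi_Q) a b).
rewrite -[LHS](pi_qscale c (a * b)) -[X in _ = X * _](pi_qscale c a).
by rewrite -[RHS](rmorphM (\pi_Q)) scalerAl.
Qed.
HB.instance Definition _ := GRing.Lmodule_isLalgebra.Build F Q qscaleAl.
HB.instance Definition _ := GRing.Lalgebra_isComAlgebra.Build F Q.

End IdealQuotientAlgebra.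

Section GeneratedIdeal.
Variables (A : comNzRingType) (G : set A).

Definition ideal_gen : {pred A} := fun f =>
  `[< exists s : seq (A * A),
        (forall t, t \in s -> G t.2) /\ f = \sum_(t <- s) t.1 * t.2 >].

Lemma ideal_gen_closed : 1 \notin ideal_gen -> idealr_closed ideal_gen.
Proof.
move=> n1; split=> //.
  by apply/asboolP; exists [::]; rewrite big_nil.
move=> a f g /asboolP [s [sG ->]] /asboolP [t [tG ->]]; apply/asboolP.
exists ([seq (a * u.1, u.2) | u <- s] ++ t); split.
  by move=> u; rewrite mem_cat => /orP [/mapP [v /sG ? ->] //|/tG].
rewrite big_cat big_map mulr_sumr /=; congr (_ + _).
by apply: eq_bigr => u _; rewrite mulrA.
Qed.

Lemma ideal_gen_proper (B : nzRingType) (h : {rmorphism A -> B}) :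
  (forall g, G g -> h g = 0) -> 1 \notin ideal_gen.
Proof.
move=> h0; apply/negP => /asboolP [s [sG]] /(congr1 h).
rewrite rmorph1 raddf_sum big_seq big1 => [/eqP|t ts].
  by rewrite oner_eq0.
by rewrite [LHS](rmorphM h) (h0 t.2) ?mulr0 //; apply: sG.
Qed.

End GeneratedIdeal.

Section Complexes.
Local Open Scope nat_scope.

Definition facets n (D : {set {set 'I_n}}) : {set {set 'I_n}} :=
  [set F | maxset (mem D) F].

(* Pure of dimension d - 1, with vertex set exactly 'I_n. *)
Record pure_complex (n d : nat) := PureComplex {
  faces :> {set {set 'I_n}};
  faces0 : finset.set0 \in faces;
  facesS : forall F G : {set 'I_n}, F \in faces -> G \subset F -> G \in faces;
  faces1 : forall i, [set i] \in faces;
  faces_pure : forall F, F \in facets faces -> #|F| = d }.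

Lemma facet_exists n d (D : pure_complex n d) : exists F, F \in facets D.
Proof.
have [F mF _] := @maxset_exists _ (mem (faces D)) _ (faces0 D).
by exists F; rewrite inE.
Qed.

End Complexes.

(* Geometric realization, in barycentric coordinates. *)
Definition realization (R : realType) n (D : {set {set 'I_n}}) : set 'rV[R]_n :=
  [set x | [/\ forall i, 0 <= x ord0 i,
               \sum_i x ord0 i = 1 &
               [set i | x ord0 i != 0]%SET \in D]]%classic.
Arguments realization R {n} D _.

(* The faces of dimension at most d - 3, i.e. of cardinality at most d - 2. *)
Definition codim2_skeleton n d (D : pure_complex n d) : {set {set 'I_n}} :=
  [set G in (D : {set {set 'I_n}}) | (#|G|.+2 <= d)%N]%SET.

Definition pseudomanifold (R : realType) n d (D : pure_complex n d) : Prop :=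
  (forall G, G \in (D : {set {set 'I_n}}) -> #|G|.+1 = d ->
     #|[set F in facets D | G \subset F]%SET| = 2%N) /\
  (forall x, realization R D x ->
     connected (connected_component (realization R D) x
                `\` realization R (codim2_skeleton D))%classic).

(* The coefficient of [G] in the boundary of \sum_F c F [F], faces being
   ordered increasingly: [v |: G] has v in position #|{u in G | u < v}|. *)
Definition boundary (k : fieldType) n (c : {set 'I_n} -> k) (G : {set 'I_n}) : k :=
  \sum_(v | v \notin G) (-1) ^+ #|[set u in G | (u < v)%N]%SET| * c (v |: G)%SET.

(* eps F is the parity of the ordering of F relative to the increasing one, so
   that the sign of F is (-1) ^+ eps F; its values off the facets are unused. *)
Definition is_orientation (k : fieldType) n d (D : pure_complex n d)
    (eps : {set 'I_n} -> bool) : Prop :=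
  forall G, boundary
    (fun F => if F \in facets D then (-1) ^+ eps F else 0 : k) G = 0.

Section StanleyReisner.
Variables (k : fieldType) (n d : nat).

Definition genK : fieldType := {fraction {mpoly k[d * n]}}.

Definition gen_a (i : 'I_d) (j : 'I_n) : genK :=
  tofrac ('X_(mxvec_index i j) : {mpoly k[d * n]}).

(* [enum F] lists F increasingly. *)
Definition bracket (F : {set 'I_n}) : genK :=
  \det (\matrix_(i < d, m < d) [seq gen_a i j | j <- enum F]`_m).

Lemma bracket_neq0 (F : {set 'I_n}) : #|F| = d -> bracket F != 0.
Proof.
move=> cF.
pose M : 'M[{mpoly k[d * n]}]_d :=
  \matrix_(i < d, m < d) [seq 'X_(mxvec_index i j) | j <- enum F]`_m.
have -> : bracket F = tofrac (\det M).
  rewrite -det_map_mx; congr (\det _); apply/matrixP => i m; rewrite !mxE.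
  have [j0 _] : exists j0 : 'I_n, true.
    have : (0 < #|F|)%N by rewrite cF (leq_ltn_trans _ (ltn_ord m)).
    by case/card_gt0P => j _; exists j.
  have sm : (m < size (enum F))%N by rewrite -cardE cF.
  by rewrite !(nth_map j0).
rewrite tofrac_eq0.
pose v (l : 'I_(d * n)) : k :=
  \sum_(i < d) \sum_(j in F | index j (enum F) == i :> nat)
    (mxvec_index i j == l)%:R.
suff : meval v (\det M) != 0 by apply: contra_neq => ->; rewrite meval0.
rewrite -det_map_mx [X in \det X](_ : _ = 1%:M) ?det1 ?oner_eq0 //.
apply/matrixP => i m; rewrite !mxE.
have [j0 _] : exists j0 : 'I_n, true.
  have : (0 < #|F|)%N by rewrite cF (leq_ltn_trans _ (ltn_ord m)).
  by case/card_gt0P => j _; exists j.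
have sm : (m < size (enum F))%N by rewrite -cardE cF.
rewrite (nth_map j0) // [LHS]mevalXU /v.
set j1 := nth j0 (enum F) m.
have j1F : j1 \in F by rewrite -mem_enum mem_nth.
have ij1 : index j1 (enum F) = m by rewrite index_uniq // enum_uniq.
have inj i1 i2 (j2 j3 : 'I_n) :
    (mxvec_index i1 j2 == mxvec_index i2 j3 :> 'I_(d * n)) =
    (i1 == i2) && (j2 == j3).
  by rewrite (inj_eq (@cast_ord_inj _ _ _)) (inj_eq enum_rank_inj) xpair_eqE.
rewrite (bigD1 i) //= [X in _ + X]big1 ?addr0; last first.
  by move=> i' ne; apply: big1 => j _; rewrite inj (negPf ne).
have [->|ne] := eqVneq i m.
  rewrite (bigD1 j1) /= ?j1F ?ij1 ?eqxx //.
  rewrite big1 ?addr0 // => j /andP [_ ne].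
  by rewrite inj (negPf ne) andbF.
apply: big1 => j /andP [jF /eqP ij]; rewrite inj eqxx /=.
case: eqP => // ej; case/negP: ne; rewrite -val_eqE /= -ij ej.
by rewrite ij1.
Qed.

Variable D : pure_complex n d.

Definition SR_gens : set {mpoly genK[n]} :=
  [set f | exists2 G : {set 'I_n},
     G \notin (D : {set {set 'I_n}}) & f = \prod_(j in G) 'X_j]%classic.

Definition SR_ideal : {pred {mpoly genK[n]}} := ideal_gen SR_gens.

Lemma SR_gens_eval0 f : SR_gens f -> meval (fun=> 0) f = 0.
Proof.
case=> G GD ->; have [j jG] : exists j, j \in G.
  by apply/set0Pn; apply: contraNneq GD => ->; apply: faces0.
by rewrite (bigD1 j) //= rmorphM /= mevalXU mul0r.
Qed.

Lemma SR_ideal_closed : idealr_closed SR_ideal.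
Proof. exact/ideal_gen_closed/ideal_gen_proper/SR_gens_eval0. Qed.
HB.instance Definition _ := isIdealr.Build _ SR_ideal SR_ideal_closed.

Definition SR_ring : comAlgType genK := {ideal_quot SR_ideal}.

Definition toSR : {mpoly genK[n]} -> SR_ring := \pi_{ideal_quot SR_ideal}.

Fact toSR_is_zmod_morphism : zmod_morphism toSR.
Proof. by move=> f g; rewrite [LHS](raddfB (\pi_{ideal_quot SR_ideal})). Qed.
Fact toSR_is_monoid_morphism : monoid_morphism toSR.
Proof.
split; first by rewrite [LHS](rmorph1 (\pi_{ideal_quot SR_ideal})).
by move=> f g; rewrite [LHS](rmorphM (\pi_{ideal_quot SR_ideal})).
Qed.
HB.instance Definition _ :=
  GRing.isZmodMorphism.Build {mpoly genK[n]} SR_ring toSR toSR_is_zmod_morphism.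
HB.instance Definition _ :=
  GRing.isMonoidMorphism.Build {mpoly genK[n]} SR_ring toSR
    toSR_is_monoid_morphism.

Definition mu (i : 'I_d) : SR_ring := toSR (\sum_(j < n) gen_a i j *: 'X_j).

Definition lsop_ideal : {pred SR_ring} := ideal_gen (range mu).

Lemma lsop_proper : 1 \notin lsop_ideal.
Proof.
apply/negP => /asboolP [s [sG]].
have SRker f : f \in SR_ideal -> meval (fun=> 0) f = 0.
  move=> /asboolP [t [tG ->]].
  rewrite raddf_sum big_seq big1 // => u ut.
  by rewrite [LHS]mevalM (SR_gens_eval0 (tG _ ut)) mulr0.
have toSRK f g : toSR f = toSR g -> meval (fun=> 0) f = meval (fun=> 0) g.
  move/eqP; rewrite -Quotient.idealrBE => /SRker /eqP.
  by rewrite raddfB subr_eq0 => /eqP.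
have reprSR (u : SR_ring) : toSR (repr (u : {ideal_quot SR_ideal})) = u.
  exact: reprK.
pose r (u : SR_ring) : {mpoly genK[n]} := repr (u : {ideal_quot SR_ideal}).
have -> : \sum_(t <- s) t.1 * t.2 = toSR (\sum_(t <- s) r t.1 * r t.2).
  rewrite [RHS](raddf_sum toSR); apply: eq_bigr => t _.
  by rewrite [RHS](rmorphM toSR); congr (_ * _); apply/esym/reprSR.
rewrite -[1](rmorph1 toSR) => /toSRK.
rewrite rmorph1 raddf_sum big_seq big1 => [/eqP|t ts].
  by rewrite oner_eq0.
have [i _ eqi] := sG _ ts.
rewrite [LHS]mevalM (toSRK (r t.2) (\sum_(j < n) gen_a i j *: 'X_j)).
  rewrite raddf_sum big1 ?mulr0 // => j _.
  by rewrite [LHS]mevalZ mevalXU mulr0.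
by apply: etrans (reprSR _) _; rewrite -eqi.
Qed.

Lemma lsop_ideal_closed : idealr_closed lsop_ideal.
Proof. exact/ideal_gen_closed/lsop_proper. Qed.
HB.instance Definition _ := isIdealr.Build _ lsop_ideal lsop_ideal_closed.

Definition H_ring : comAlgType genK := {ideal_quot lsop_ideal}.

Definition toH (f : {mpoly genK[n]}) : H_ring :=
  \pi_{ideal_quot lsop_ideal} (toSR f).

Definition H_gr (m : nat) : set H_ring :=
  [set toH f | f in [set f : {mpoly genK[n]} | f \is m.-homog]]%classic.

(* The degree map H^d -> K, encoded as the linear form on H that extends it by
   zero on H^m, m != d. *)
Record degree_map (eps : {set 'I_n} -> bool) := DegreeMap {
  deg_form :> {scalar H_ring};
  deg_off : forall m g, m <> d -> H_gr m g -> deg_form g = 0;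
  deg_facet : forall F, F \in facets D ->
    deg_form (toH (\prod_(j in F) 'X_j)) = (-1) ^+ eps F / bracket F }.

Variables (eps : {set 'I_n} -> bool) (deg : degree_map eps).

(* For m > d the condition is vacuous, as H^(d - m) = 0. *)
Definition pairing_ker (m : nat) : set H_ring :=
  [set g | H_gr m g /\
     forall e h, (m + e = d)%N -> H_gr e h -> deg (g * h) = 0]%classic.

(* The direct sum over m of the kernels in degree m. *)
Definition gorenstein_ideal : {pred H_ring} := fun g =>
  `[< exists s : seq H_ring,
        (forall u, u \in s -> exists m, pairing_ker m u) /\
        g = \sum_(u <- s) u >].

Fact toH_is_zmod_morphism : zmod_morphism toH.
Proof.
move=> f g; rewrite /toH (raddfB toSR).
by rewrite [LHS](raddfB (\pi_{ideal_quot lsop_ideal})).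
Qed.
Fact toH_is_monoid_morphism : monoid_morphism toH.
Proof.
split.
  by rewrite /toH (rmorph1 toSR) [LHS](rmorph1 (\pi_{ideal_quot lsop_ideal})).
move=> f g; rewrite /toH (rmorphM toSR).
by rewrite [LHS](rmorphM (\pi_{ideal_quot lsop_ideal})).
Qed.
HB.instance Definition _ :=
  GRing.isZmodMorphism.Build {mpoly genK[n]} H_ring toH toH_is_zmod_morphism.
HB.instance Definition _ :=
  GRing.isMonoidMorphism.Build {mpoly genK[n]} H_ring toH toH_is_monoid_morphism.

Lemma toH_surj (h : H_ring) : exists f, toH f = h.
Proof.
exists (repr (repr (h : {ideal_quot lsop_ideal}) : {ideal_quot SR_ideal})).
by rewrite /toH /toSR reprK; apply: (@reprK _ {ideal_quot lsop_ideal}).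
Qed.

Lemma H_grM m e g h : H_gr m g -> H_gr e h -> H_gr (m + e) (g * h).
Proof.
move=> [f fm <-] [f' fe <-]; exists (f * f'); last by rewrite rmorphM.
exact: dhomogM.
Qed.

Lemma H_decomp (h : H_ring) : exists s : seq H_ring,
  (forall u, u \in s -> exists m, H_gr m u) /\ h = \sum_(u <- s) u.
Proof.
have [f <-] := toH_surj h.
exists [seq toH (f@_m *: 'X_[m]) | m <- msupp f]; split.
  move=> u /mapP [m _ ->]; exists (mdeg m); exists (f@_m *: 'X_[m]) => //=.
  by apply: dhomogZ; rewrite dhomogX.
by rewrite big_map -raddf_sum /= -mpolyE.
Qed.

Lemma gorenstein_proper : 1 \notin gorenstein_ideal.
Proof.
apply/negP => /asboolP [s [sK e1]].
have [F FD] := facet_exists D.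
have := deg_facet deg FD; set x := toH _.
have x0 : deg x = 0.
  rewrite -[x]mul1r e1 mulr_suml raddf_sum big_seq big1 // => u us.
  have [m [um uK]] := sK _ us.
  have [t [tH ->]] := H_decomp x.
  rewrite mulr_sumr raddf_sum big_seq big1 // => h ht.
  have [e he] := tH _ ht.
  have [med|/eqP med] := eqVneq (m + e)%N d; first exact: uK med he.
  exact: deg_off med (H_grM um he).
rewrite x0 => /esym/eqP; rewrite mulf_eq0 signr_eq0 invr_eq0 /=.
by rewrite (negPf (bracket_neq0 (faces_pure FD))).
Qed.

Lemma gorenstein_ideal_closed : idealr_closed gorenstein_ideal.
Proof.
split; last 1 first.
- move=> a f g /asboolP [s [sK ->]] /asboolP [t [tK ->]]; apply/asboolP.
  have [r [rH ->]] := H_decomp a.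
  exists ([seq u * v | u <- r, v <- s] ++ t); split.
    move=> u; rewrite mem_cat => /orP [/allpairsP [[b c] /= [br cs ->]]|/tK //].
    have [e be] := rH _ br; have [m [cm cK]] := sK _ cs.
    exists (e + m)%N; split; first exact: H_grM.
    move=> e' h eq he; rewrite mulrAC mulrC; apply: (cK (e + e')%N).
      by rewrite addnCA addnA.
    exact: H_grM.
  rewrite big_cat big_allpairs_dep mulr_suml; congr (_ + _).
  by apply: eq_bigr => u _; rewrite mulr_sumr.
- by apply/asboolP; exists [::]; rewrite big_nil.
exact: gorenstein_proper.
Qed.
HB.instance Definition _ :=
  isIdealr.Build _ gorenstein_ideal gorenstein_ideal_closed.

Definition Hbar : comAlgType genK := {ideal_quot gorenstein_ideal}.

Definition toHbar (g : H_ring) : Hbar := \pi_{ideal_quot gorenstein_ideal} g.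

Definition Hbar_gr (m : nat) : set Hbar := [set toHbar g | g in H_gr m]%classic.

Definition ell : Hbar := toHbar (toH (\sum_(j < n) 'X_j)).

End StanleyReisner.

Arguments Hbar_gr {k n d D eps} deg m _.
Arguments ell {k n d D eps} deg.

Definition has_dim (F : fieldType) (V : lmodType F) (U : set V) (r : nat) : Prop :=
  exists b : 'I_r -> V,
  [/\ forall i, U (b i),
      forall c : 'I_r -> F, \sum_i c i *: b i = 0 -> forall i, c i = 0 &
      forall v, U v -> exists c : 'I_r -> F, v = \sum_i c i *: b i].

(* Main.v *)
Require Import Defs.
From HB Require Import structures.
From mathcomp Require Import all_boot all_order all_algebra.
From mathcomp Require Import generic_quotient fraction.
From mathcomp Require Import mpoly.
From mathcomp Require Import boolp classical_sets reals topology.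
From mathcomp Require Import ring.

Set Implicit Arguments.
Unset Strict Implicit.
Unset Printing Implicit Defensive.

Import GRing.Theory numFieldTopology.Exports.
Local Open Scope ring_scope.

(** Adjoin to K a generic vector v = (v_1, ..., v_d). For a facet S let c_S be
the solution of A_S c_S = v, where A_S has columns a_j for j in S, extended by
zero off S. The degree map is then the restriction to degree d of
  L(f) = sum over facets S of eps_S f(c_S) / (det A_S * prod_(j in S) c_S(j))
[degf_lee]. Indeed L kills the non-faces, takes the prescribed values on the
facets and satisfies L(mu_i f) = v_i L(f); the cycle condition makes it vanish
in degrees below d [lee_low].

The derivations d/da_ij and d/dv_i act on each summand x of L by
d/da_ij x = - d/dv_i (c_S(j) x). Hence an operator W that is a product of
derivations d/da_ij with each row i occurring p - 1 times, and with column
monomial x^u, acts on the summand of x^N as the operator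
prod_i (d/dv_i)^(p-1) acts on the summand of x^(N+u) [iter_deriv_good]. That
last operator is the top differential operator on polynomials in v modulo p-th
powers, and c_S is a linear system of coordinates, so the result is, up to the
sign (-1)^d, the p-th power of the summand of x^((N+u)/p), or 0 if N + u is not
divisible by p [T_term]. Since p-th powers are constants and Frobenius is
additive, summing over S gives
  W(deg(G^p x^N)) = (-1)^d deg(G x^((N+u)/p))^p or 0            [D_lee].

Suppose now that g^p ell^M = 0 with p m + M <= d, and write M = p q + r with
r < p. Put G = g ell^q. For a monomial b in the complementary degree write
b^p = x_j^r x^N x^u, where x_j divides b if r > 0. Since r < p, no other monomial
of ell^r multiplies x^N x^u to a p-th power, so applying W to
deg(G^p ell^r x^N) = 0 yields deg(G b) = 0; thus g ell^q = 0
[frobenius_descent, Hbar_descent]. For M = 0 this is (i). If g ell^M = 0 then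
g^p ell^M = 0, and M strictly decreases to M %/ p, until g = 0: this is (ii) and
(iii) [ell_mul_eq0]. Finally (iv) follows from (iii). *)

(** * Derivations and their extension to fraction fields *)

Definition derivation (R : nzRingType) (D : R -> R) : Prop :=
  (forall x y, D (x + y) = D x + D y) /\
  (forall x y, D (x * y) = D x * y + x * D y).

Section DerivationRing.
Variables (R : comNzRingType) (D : R -> R).
Hypothesis derD : derivation D.

Lemma derivD x y : D (x + y) = D x + D y. Proof. exact: derD.1. Qed.
Lemma derivM x y : D (x * y) = D x * y + x * D y. Proof. exact: derD.2. Qed.
Lemma deriv0 : D 0 = 0.
Proof. by apply: (addrI (D 0)); rewrite -derivD !addr0. Qed.
Lemma derivN x : D (- x) = - D x.
Proof. by apply: (addrI (D x)); rewrite -derivD !subrr deriv0. Qed.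
Lemma derivB x y : D (x - y) = D x - D y.
Proof. by rewrite derivD derivN. Qed.
Lemma deriv1 : D 1 = 0.
Proof.
by apply: (addrI (D 1)); rewrite addr0 -{3}(mulr1 1) derivM mulr1 mul1r.
Qed.
Lemma deriv_nat (b : nat) : D b%:R = 0.
Proof. by elim: b => [|b IH]; rewrite ?deriv0 // -natr1 derivD IH deriv1 addr0. Qed.
Lemma deriv_sum (I : Type) (r : seq I) (P : pred I) (f : I -> R) :
  D (\sum_(i <- r | P i) f i) = \sum_(i <- r | P i) D (f i).
Proof. exact: (big_morph D derivD deriv0). Qed.
Lemma derivX x m : D (x ^+ m) = m%:R * x ^+ m.-1 * D x.
Proof.
elim: m => [|m IH]; first by rewrite expr0 deriv1 !mul0r.
rewrite exprS derivM IH -natr1 /=; case: m {IH} => [|m] /=.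
  by rewrite expr0; ring.
by rewrite exprS; ring.
Qed.
Lemma deriv_const_prod (I : Type) (r : seq I) (P : pred I) (f : I -> R) :
  (forall i, P i -> D (f i) = 0) -> D (\prod_(i <- r | P i) f i) = 0.
Proof.
move=> f0; elim/big_rec: _ => [|i x Pi Dx]; first exact: deriv1.
by rewrite derivM f0 // Dx mul0r mulr0 addr0.
Qed.
Lemma deriv_sign (b : nat) : D ((-1) ^+ b) = 0.
Proof. by rewrite derivX derivN deriv1 oppr0 mulr0. Qed.
Lemma deriv_const_det m (A : 'M[R]_m) : (forall i j, D (A i j) = 0) -> D (\det A) = 0.
Proof.
move=> A0; rewrite deriv_sum big1 // => s _.
by rewrite derivM deriv_sign mul0r add0r deriv_const_prod ?mulr0.
Qed.
Lemma deriv_pchar (p : nat) x : p \in [pchar R] -> D (x ^+ p) = 0.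
Proof. by move=> cp; rewrite derivX (pcharf0 cp) !mul0r. Qed.
End DerivationRing.

Section DerivationField.
Variables (F : fieldType) (D : F -> F).
Hypothesis derD : derivation D.

Lemma derivV x : D x^-1 = - (D x / x ^+ 2).
Proof.
have [->|x0] := eqVneq x 0; first by rewrite invr0 (deriv0 derD) mul0r oppr0.
have : D (x * x^-1) = 0 by rewrite mulfV // (deriv1 derD).
rewrite (derivM derD) => /eqP; rewrite addrC addr_eq0 => /eqP e.
by apply: (mulfI x0); rewrite e; field.
Qed.

Lemma deriv_div x y : y != 0 -> D (x / y) = (D x * y - x * D y) / y ^+ 2.
Proof. by move=> y0; rewrite (derivM derD) derivV; field. Qed.

End DerivationField.

(** The commutator of two derivations is a derivation, so it vanishes on x / y
    as soon as it vanishes on x and y. *)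
Lemma derivation_comm_div (F : fieldType) (D D' : F -> F) x y :
  derivation D -> derivation D' -> y != 0 ->
  D (D' x) = D' (D x) -> D (D' y) = D' (D y) ->
  D (D' (x / y)) = D' (D (x / y)).
Proof.
move=> dD dD' y0 ex ey; have y2 : y ^+ 2 != 0 by rewrite expf_neq0.
rewrite (deriv_div dD) // (deriv_div dD') // (deriv_div dD) // (deriv_div dD') //.
rewrite !(derivB dD, derivB dD', derivM dD, derivM dD', derivX dD, derivX dD') ex ey.
by field.
Qed.

Section QuotientRule.
Variable F : fieldType.
Implicit Types a b f g : F.

(** Two representatives a / b and f / g of one fraction satisfy a g = f b;
    differentiating this equality shows that the quotient rule is well
    defined. *)
Lemma quotient_rule_wd a b f g a' b' f' g' : b != 0 -> g != 0 ->
  a * g = f * b -> a' * g + a * g' = f' * b + f * b' ->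
  (a' * b - a * b') / b ^+ 2 = (f' * g - f * g') / g ^+ 2.
Proof.
move=> b0 g0 ab abD.
have ea : a = f * b / g by rewrite -ab mulfK.
have ea' : a' = (f' * b + f * b' - a * g') / g.
  by apply: (mulIf g0); rewrite mulfVK // -abD addrK.
by rewrite ea' ea; field; rewrite g0.
Qed.

Lemma quotient_ruleD f g f' g' a b a' b' : g != 0 -> b != 0 ->
  ((f' * b + f * b' + (a' * g + a * g')) * (g * b)
     - (f * b + a * g) * (g' * b + g * b')) / (g * b) ^+ 2 =
  (f' * g - f * g') / g ^+ 2 + (a' * b - a * b') / b ^+ 2.
Proof. by move=> g0 b0; field; rewrite ?g0 ?b0. Qed.

Lemma quotient_ruleM f g f' g' a b a' b' : g != 0 -> b != 0 ->
  ((f' * a + f * a') * (g * b) - (f * a) * (g' * b + g * b')) / (g * b) ^+ 2 =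
  (f' * g - f * g') / g ^+ 2 * (a / b) + f / g * ((a' * b - a * b') / b ^+ 2).
Proof. by move=> g0 b0; field; rewrite ?g0 ?b0. Qed.

End QuotientRule.

Section FractionDerivation.
Variables (R : idomainType).
Local Notation F := {fraction R}.

Lemma fraction_repr (x : F) :
  x = tofrac (\n_(repr x)) / tofrac (\d_(repr x)).
Proof.
rewrite -[LHS]reprK; case: (repr x) => [[f g] /= g0]; unlock tofrac.
rewrite -[X in _ * X]FracField.pi_inv -[RHS]FracField.pi_mul.
rewrite /FracField.mulf /FracField.invf !numden_Ratio ?oner_neq0 ?mul1r ?mulr1 //.
by apply/eqP; rewrite FracField.equivf_def /= !numden_Ratio //= mulrC.
Qed.

Lemma fraction_ind (P : F -> Prop) :
  (forall f g, g != 0 -> P (tofrac f / tofrac g)) -> forall x, P x.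
Proof. by move=> Pfg x; rewrite (fraction_repr x); apply/Pfg/denom_ratioP. Qed.

(** The quotient rule for a chosen representative; by frac_derivE the choice
    is immaterial. *)
Definition frac_deriv (D : R -> R) (x : F) : F :=
  let: f := \n_(repr x) in let: g := \d_(repr x) in
  (tofrac (D f) * tofrac g - tofrac f * tofrac (D g)) / tofrac g ^+ 2.

Section Extend.
Variable D : R -> R.
Hypothesis derD : derivation D.

Lemma frac_derivE f g : g != 0 -> frac_deriv D (tofrac f / tofrac g) =
  (tofrac (D f) * tofrac g - tofrac f * tofrac (D g)) / tofrac g ^+ 2.
Proof.
rewrite -tofrac_eq0 => g0; rewrite /frac_deriv.
set x := tofrac f / tofrac g; have := fraction_repr x.
have := denom_ratioP (repr x); rewrite -tofrac_eq0.
move: (\n_(repr x)) (\d_(repr x)) => a b b0; rewrite /x => e.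
have ab : a * g = f * b.
  apply/eqP; rewrite -tofrac_eq !rmorphM /=; apply/eqP.
  apply: (mulIf (invr_neq0 b0)); rewrite mulrAC -e mulfK // .
  by rewrite -mulrA mulVf // mulr1.
have := congr1 D ab; rewrite !(derivM derD) => /(congr1 (@tofrac R)).
rewrite !rmorphD !rmorphM /= => abD.
have := congr1 (@tofrac R) ab; rewrite !rmorphM /= => abF {ab e x}.
exact: quotient_rule_wd.
Qed.

Lemma frac_deriv_tofrac f : frac_deriv D (tofrac f) = tofrac (D f).
Proof.
have := @frac_derivE f 1 (oner_neq0 _).
by rewrite rmorph1 divr1 (deriv1 derD) rmorph0 mulr0 subr0 mulr1 expr1n divr1.
Qed.

Lemma frac_deriv_derivation : derivation (frac_deriv D).
Proof.
split; apply: fraction_ind => f g g0; apply: fraction_ind => f' g' g'0;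
  have gF := g0; have gF' := g'0; rewrite -tofrac_eq0 in gF; rewrite -tofrac_eq0 in gF'.
- rewrite addf_div // -!rmorphM -rmorphD.
  rewrite !frac_derivE ?mulf_neq0 //.
  rewrite !(derivD derD, derivM derD) !(rmorphD, rmorphM) /=.
  exact: quotient_ruleD.
- rewrite mulf_div -!rmorphM !frac_derivE ?mulf_neq0 //.
  rewrite !(derivM derD) !(rmorphD, rmorphM) /=.
  exact: quotient_ruleM.
Qed.

End Extend.

Lemma frac_deriv_comm (D D' : R -> R) : derivation D -> derivation D' ->
  (forall f, D (D' f) = D' (D f)) ->
  forall x, frac_deriv D (frac_deriv D' x) = frac_deriv D' (frac_deriv D x).
Proof.
move=> derD derD' DD'.
have dF := frac_deriv_derivation derD; have dF' := frac_deriv_derivation derD'.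
apply: fraction_ind => f g; rewrite -tofrac_eq0 => g0.
apply: (derivation_comm_div dF dF' g0);
  by rewrite !frac_deriv_tofrac // DD'.
Qed.

End FractionDerivation.

Section CoefDerivation.
Variables (R : idomainType) (d : nat).

Lemma mderiv_derivation (i : 'I_d) : derivation (@mderiv d R i).
Proof. by split=> f g; [rewrite mderivD | rewrite mderivM]. Qed.

Variable D : R -> R.
Hypothesis derD : derivation D.

Definition coef_deriv (f : {mpoly R[d]}) : {mpoly R[d]} := map_mpoly D f.

Lemma mcoeff_coef_deriv m f : (coef_deriv f)@_m = D f@_m.
Proof.
pose DM := GRing.isZmodMorphism.Build R R D (derivB derD).
pose Da : {additive R -> R} := HB.pack D DM.
exact: (@mcoeff_map_mpoly d R R Da m f).
Qed.

Lemma coef_deriv_derivation : derivation coef_deriv.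
Proof.
split=> f g; apply/mpolyP => m; rewrite ?mcoeffD !mcoeff_coef_deriv.
  by rewrite mcoeffD (derivD derD).
rewrite !mcoeffM (deriv_sum derD) -big_split /=; apply: eq_bigr => k _.
by rewrite !mcoeff_coef_deriv (derivM derD).
Qed.

Lemma coef_derivC c : coef_deriv c%:MP = (D c)%:MP.
Proof.
apply/mpolyP => m; rewrite mcoeff_coef_deriv !mcoeffC.
by case: eqP => _; rewrite ?mulr1 // !mulr0 (deriv0 derD).
Qed.

Lemma coef_deriv_X m : coef_deriv 'X_[m] = 0.
Proof.
apply/mpolyP => k; rewrite mcoeff_coef_deriv mcoeffX mcoeff0.
exact: deriv_nat.
Qed.

Lemma coef_deriv_mderiv (i : 'I_d) f :
  coef_deriv (mderiv i f) = mderiv i (coef_deriv f).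
Proof.
apply/mpolyP => m; rewrite mcoeff_coef_deriv !mcoeff_deriv mcoeff_coef_deriv.
by rewrite -mulr_natr (derivM derD) (deriv_nat derD) mulr0 addr0 mulr_natr.
Qed.

End CoefDerivation.

(** * The Frobenius identity for a single facet *)

Section Words.
Variables (F : fieldType) (I : Type) (op : I -> F -> F).
Hypothesis op_der : forall i, derivation (op i).

Definition iter_deriv (w : seq I) (x : F) : F := foldl (fun y i => op i y) x w.

Lemma iter_deriv_cons i w x : iter_deriv (i :: w) x = iter_deriv w (op i x). Proof. by []. Qed.

Lemma iter_deriv_cat w w' x : iter_deriv (w ++ w') x = iter_deriv w' (iter_deriv w x).
Proof. exact: foldl_cat. Qed.

Lemma iter_deriv0 w : iter_deriv w 0 = 0.
Proof. by elim: w => //= i w IH; rewrite (deriv0 (op_der i)). Qed.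

Lemma iter_derivD w x y : iter_deriv w (x + y) = iter_deriv w x + iter_deriv w y.
Proof. by elim: w x y => //= i w IH x y; rewrite (derivD (op_der i)) IH. Qed.

Lemma iter_derivN w x : iter_deriv w (- x) = - iter_deriv w x.
Proof. by elim: w x => //= i w IH x; rewrite (derivN (op_der i)) IH. Qed.

Lemma iter_deriv_sum w (J : Type) (r : seq J) (P : pred J) (f : J -> F) :
  iter_deriv w (\sum_(j <- r | P j) f j) = \sum_(j <- r | P j) iter_deriv w (f j).
Proof. exact: (big_morph _ (iter_derivD w) (iter_deriv0 w)). Qed.

Lemma iter_deriv_const w k x : (forall i, op i k = 0) -> iter_deriv w (k * x) = k * iter_deriv w x.
Proof.
by move=> k0; elim: w x => //= i w IH x; rewrite (derivM (op_der i)) k0 mul0r add0r IH.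
Qed.

Lemma iter_deriv_pchar w (p : nat) y x : p \in [pchar F] ->
  iter_deriv w (y ^+ p * x) = y ^+ p * iter_deriv w x.
Proof. by move=> cp; apply: iter_deriv_const => i; rewrite (deriv_pchar (op_der i)). Qed.

Lemma iter_deriv_nseq i k m y z : op i m = 0 -> op i y = z -> op i z = 0 ->
  iter_deriv (nseq k i) (m * y ^+ k) = k`!%:R * m * z ^+ k.
Proof.
move=> m0 yz z0; elim: k m m0 => [|k IH] m m0 /=; first by rewrite mul1r.
have dI := op_der i.
have -> : op i (m * y ^+ k.+1) = m * k.+1%:R * z * y ^+ k.
  by rewrite (derivM dI) m0 (derivX dI) /= yz; ring.
rewrite IH; last by rewrite !(derivM dI) m0 z0 (deriv_nat dI); ring.
by rewrite factS natrM exprS; ring.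
Qed.

(** Annihilation by every word of length s. For partial derivatives this
    captures degree less than s without any expansion into monomials. *)
Fixpoint killed (s : nat) (x : F) : Prop :=
  if s is s'.+1 then forall i, killed s' (op i x) else x = 0.

Lemma killedD s x y : killed s x -> killed s y -> killed s (x + y).
Proof.
elim: s x y => [|s IH] x y /=; first by move=> -> ->; rewrite addr0.
by move=> xk yk i; rewrite (derivD (op_der i)); apply: IH.
Qed.

(** Degrees add up under products, by the Leibniz rule. *)
Lemma killedM s t x y : killed s.+1 x -> killed t.+1 y -> killed (s + t).+1 (x * y).
Proof.
elim: s t x y => [|s IHs] t x y.
  move=> x0; elim: t y => [|t IHt] y yk i; rewrite (derivM (op_der i)) (x0 i) mul0r add0r.
    by rewrite (yk i) mulr0.
  exact: (IHt _ (yk i)).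
move=> xk; elim: t y => [|t IHt] y yk i; rewrite (derivM (op_der i)).
  rewrite (yk i) mulr0 addr0; exact: (IHs 0%N _ _ (xk i) yk).
apply: (@killedD (s + t.+1).+1); first exact: (IHs t.+1 _ _ (xk i) yk).
by have := IHt _ (yk i); rewrite addnS.
Qed.

Lemma killed1 : killed 1 1.
Proof. by move=> i; rewrite /= (deriv1 (op_der i)). Qed.

Lemma killedX k x : killed 2 x -> killed k.+1 (x ^+ k).
Proof.
move=> xk; elim: k => [|k IH]; first exact: killed1.
by rewrite exprS; apply: (killedM (s := 1)).
Qed.

Lemma killed_prod (J : Type) (r : seq J) (e : J -> nat) (f : J -> F) :
  (forall j, killed (e j).+1 (f j)) ->
  killed (\sum_(j <- r) e j)%N.+1 (\prod_(j <- r) f j).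
Proof.
move=> ef; elim/big_rec2: _ => [|j x s _ sx]; first exact: killed1.
exact: killedM.
Qed.

Lemma killed_iter_deriv s w x : killed s x -> (s <= size w)%N -> iter_deriv w x = 0.
Proof.
elim: s w x => [|s IH] w x; first by move=> ->; rewrite iter_deriv0.
by case: w => //= i w xk; apply: IH.
Qed.

End Words.

Section FacetIdentity.
Variables (F : fieldType) (p d n : nat).
Hypotheses (p_prime : prime p) (charp : p \in [pchar F]).
Variables (D : 'I_d * 'I_n -> F -> F) (E : 'I_d -> F -> F).
Hypothesis derD : forall ij, derivation (D ij).
Hypothesis derE : forall i, derivation (E i).
Hypothesis commDE : forall ij i x, D ij (E i x) = E i (D ij x).
Hypothesis commEE : forall i i' x, E i (E i' x) = E i' (E i x).
Variables (a : 'I_d -> 'I_n -> F) (v : 'I_d -> F).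
Hypothesis Da : forall ij i j, D ij (a i j) = (ij == (i, j))%:R.
Hypothesis Dv : forall ij i, D ij (v i) = 0.
Hypothesis Ea : forall i' i j, E i' (a i j) = 0.
Hypothesis Ev : forall i i', E i (v i') = (i == i')%:R.
Variable sg : 'I_d -> 'I_n.
Hypothesis sg_inj : injective sg.

Let A : 'M[F]_d := \matrix_(i, m) a i (sg m).
Hypothesis detA : \det A != 0.
Let B := invmx A.
Variable xv : 'cV[F]_d.
Hypothesis Axv : A *m xv = \col_i v i.
Let x m := xv m 0.
Let c (j : 'I_n) : F := \sum_(m | sg m == j) x m.
Let delta := (\det A)^-1.

Let unitA : A \in unitmx. Proof. by rewrite unitmxE unitfE. Qed.

Lemma deriv_mulmx (G : F -> F) m1 m2 m3 (M : 'M[F]_(m1, m2)) (N : 'M[F]_(m2, m3)) :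
  derivation G ->
  map_mx G (M *m N) = map_mx G M *m N + M *m map_mx G N.
Proof.
move=> dG; apply/matrixP => i j; rewrite !mxE (deriv_sum dG) -big_split.
by apply: eq_bigr => l _; rewrite !mxE (derivM dG).
Qed.

Lemma EA i : map_mx (E i) A = 0.
Proof. by apply/matrixP => r m; rewrite !mxE Ea. Qed.

(** Differentiate A x = v, here and in D_x. *)
Lemma E_x i m : E i (x m) = B m i.
Proof.
have := congr1 (map_mx (E i)) Axv; rewrite (deriv_mulmx _ _ (derE i)) EA mul0mx add0r.
move/(congr1 (mulmx B)); rewrite mulmxA mulVmx // mul1mx => /matrixP /(_ m 0).
rewrite [LHS]mxE /x => ->; rewrite mxE (bigD1 i) //= big1 ?addr0 => [|r ri].
  by rewrite !mxE Ev eqxx mulr1.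
by rewrite !mxE Ev eq_sym (negPf ri) mulr0.
Qed.

Lemma E_B i m r : E i (B m r) = 0.
Proof.
have := congr1 (map_mx (E i)) (mulmxV unitA).
rewrite (deriv_mulmx _ _ (derE i)) EA mul0mx add0r.
move/(congr1 (mulmx B)); rewrite mulmxA mulVmx // mul1mx => /matrixP /(_ m r).
rewrite [LHS]mxE => ->; rewrite mxE big1 // => l _; rewrite !mxE.
by rewrite (deriv_nat (derE i)) mulr0.
Qed.

Lemma E_delta i : E i delta = 0.
Proof.
rewrite /delta (derivV (derE i)) (deriv_const_det (derE i)) ?mul0r ?oppr0 //.
by move=> r m; rewrite mxE Ea.
Qed.

Lemma D_A i j r m : D (i, j) (A r m) = ((i == r) && (sg m == j))%:R.
Proof. by rewrite mxE Da xpair_eqE [j == _]eq_sym. Qed.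

Lemma D_x i j m : D (i, j) (x m) = - (c j * B m i).
Proof.
have := congr1 (map_mx (D (i, j))) Axv; rewrite (deriv_mulmx _ _ (derD _)).
have -> : map_mx (D (i, j)) (\col_i v i) = 0.
  by apply/matrixP => r l; rewrite !mxE Dv.
move/eqP; rewrite addrC addr_eq0 => /eqP /(congr1 (mulmx B)).
rewrite mulmxA mulVmx // mul1mx => /matrixP /(_ m 0).
rewrite [LHS]mxE /x => ->; rewrite mxE (bigD1 i) //= big1 ?addr0 => [|r ri].
  rewrite !mxE mulrN [c j * _]mulrC; congr (- (_ * _)).
  rewrite /c [RHS]big_mkcond; apply: eq_bigr => l _; rewrite !mxE Da xpair_eqE eqxx.
  by rewrite [j == _]eq_sym; case: (sg l == j); rewrite ?mul1r ?mul0r.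
rewrite !mxE big1 ?oppr0 ?mulr0 // => l _; rewrite !mxE Da xpair_eqE.
by rewrite eq_sym (negPf ri) mul0r.
Qed.

Lemma D_cofactor i j (M : 'M[F]_d) m :
  (forall r l, r != i -> D (i, j) (M r l) = 0) -> D (i, j) (cofactor M i m) = 0.
Proof.
move=> M0; rewrite (derivM (derD _)) (deriv_sign (derD _)) mul0r add0r.
rewrite (deriv_const_det (derD _)) ?mulr0 // => r l; rewrite !mxE.
by apply: M0; rewrite eq_sym neq_lift.
Qed.

(** Jacobi's formula: det A is linear in its row i. *)
Lemma D_delta i j : D (i, j) delta = - (\sum_(m | sg m == j) B m i) * delta.
Proof.
have DA : D (i, j) (\det A) = \det A * \sum_(m | sg m == j) B m i.
  rewrite (expand_det_row A i) (deriv_sum (derD _)) -(expand_det_row A i).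
  rewrite mulr_sumr [RHS]big_mkcond; apply: eq_bigr => m _.
  rewrite (derivM (derD _)) D_A eqxx /= D_cofactor => [|r l ri]; last first.
    by rewrite D_A eq_sym (negPf ri).
  rewrite mulr0 addr0 /B /invmx unitA !mxE.
  by case: eqP => _; rewrite ?mul0r // mul1r mulrA mulfV ?mul1r.
by rewrite /delta (derivV (derD _)) DA; field.
Qed.

Lemma E_c i j : E i (c j) = \sum_(m | sg m == j) B m i.
Proof. by rewrite (deriv_sum (derE i)); apply: eq_bigr => m _; rewrite E_x. Qed.

(** The functions of the coordinates x of v in the columns of A: on these,
    D (i, j) is minus c j times E i. *)
Let good y := forall i j, D (i, j) y = - (c j * E i y).

Lemma good1 : good 1.
Proof.
by move=> i j; rewrite (deriv1 (derD _)) (deriv1 (derE _)) mulr0 oppr0.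
Qed.

Lemma goodM y z : good y -> good z -> good (y * z).
Proof.
move=> gy gz i j; rewrite (derivM (derD _)) (derivM (derE _)) gy gz.
by ring.
Qed.

Lemma goodV y : good y -> good y^-1.
Proof.
move=> gy i j; rewrite (derivV (derD _)) (derivV (derE _)) gy.
by rewrite !mulrN mulNr !opprK mulrA.
Qed.

Lemma good_prod (J : Type) (r : seq J) (f : J -> F) :
  (forall j, good (f j)) -> good (\prod_(j <- r) f j).
Proof. by move=> gf; elim/big_rec: _ => [|j y _ gy]; [exact: good1 | exact: goodM]. Qed.

Lemma goodX y k : good y -> good (y ^+ k).
Proof.
by move=> gy; elim: k => [|k IH]; [exact: good1 | rewrite exprS; exact: goodM].
Qed.

Lemma good_x m : good (x m).
Proof. by move=> i j; rewrite D_x E_x. Qed.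

Lemma good_c l : good (c l).
Proof.
move=> i j; rewrite (deriv_sum (derD _)) E_c mulr_sumr -sumrN.
by apply: eq_bigr => m _; rewrite D_x.
Qed.

(** The derivative of the factor delta supplies exactly the term that moves c j
    inside the derivative, so that the rule can be iterated. *)
Lemma D_good i j g : good g -> D (i, j) (g * delta) = - E i (c j * g * delta).
Proof.
move=> gg; rewrite (derivM (derD _)) D_delta gg.
rewrite !(derivM (derE _)) E_delta E_c; ring.
Qed.

Lemma E_iter_deriv_D w i y : E i (iter_deriv D w y) = iter_deriv D w (E i y).
Proof. by elim: w y => //= ij w IH y; rewrite IH commDE. Qed.

Lemma E_iter_deriv_E w i y : E i (iter_deriv E w y) = iter_deriv E w (E i y).
Proof. by elim: w y => //= ij w IH y; rewrite IH commEE. Qed.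

(** Of the columns of the word only their monomial survives, because D and E
    commute. *)
Lemma iter_deriv_good w g : good g ->
  iter_deriv D w (g * delta) =
  (-1) ^+ size w * iter_deriv E (unzip1 w) (\prod_(j <- unzip2 w) c j * g * delta).
Proof.
elim: w g => [|[i j] w IH] g gg; first by rewrite /= big_nil !mul1r.
rewrite [unzip2 _]/= big_cons [unzip1 _]/= [size _]/= !iter_deriv_cons D_good //.
rewrite (iter_derivN derD) -E_iter_deriv_D IH; last exact: goodM (good_c j) gg.
rewrite (derivM (derE _)) (deriv_sign (derE _)) mul0r add0r E_iter_deriv_E.
rewrite exprS mulN1r mulNr; congr (- (_ * iter_deriv _ _ (E i _))).
by rewrite /=; ring.
Qed.

Definition rows : seq 'I_d := flatten [seq nseq p.-1 i | i <- enum 'I_d].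

Lemma size_rows : size rows = (d * p.-1)%N.
Proof.
rewrite size_flatten /shape -map_comp (eq_map (g := fun=> p.-1)) => [|i].
  by rewrite sumnE big_map big_const_seq count_predT size_enum_ord iter_addn_0 mulnC.
by rewrite /= size_nseq.
Qed.

(** A with its first t rows replaced by rows of the identity matrix. *)
Let M (t : nat) : 'M[F]_d := \matrix_(i, m) if (i < t)%N then (i == m)%:R else A i m.

(** Expand along row t: det (M t) is affine in the entry at column t, with
    slope det (M t.+1). *)
Lemma M_step (t : 'I_d) :
  D (t, sg t) (\det (M t)) = \det (M t.+1) /\ D (t, sg t) (\det (M t.+1)) = 0.
Proof.
have Mt r l : r != t -> M t.+1 r l = M t r l.
  by move=> rt; rewrite !mxE ltnS leq_eqVlt (inj_eq val_inj) (negPf rt).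
have cofE m : cofactor (M t.+1) t m = cofactor (M t) t m.
  congr (_ * \det _); apply/matrixP => r l; rewrite !mxE -!/(M _ _ _).
  by have := Mt (lift t r) (lift m l); rewrite !mxE eq_sym neq_lift => ->.
have D0 r l : r != t -> D (t, sg t) (M t r l) = 0.
  move=> rt; rewrite mxE; case: ifP => _; first exact: (deriv_nat (derD _)).
  by rewrite D_A eq_sym (negPf rt).
have D1 r l : D (t, sg t) (M t.+1 r l) = 0.
  have [->|rt] := eqVneq r t; last by rewrite Mt // D0.
  by rewrite mxE ltnSn (deriv_nat (derD _)).
split; last by apply: (deriv_const_det (derD _)) => r l; apply: D1.
rewrite (expand_det_row _ t) (deriv_sum (derD _)) (expand_det_row (M t.+1) t).
apply: eq_bigr => m _; rewrite (derivM (derD _)) cofE D_cofactor // mulr0 addr0.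
congr (_ * _); rewrite [RHS]mxE ltnSn [M t t m]mxE ltnn D_A eqxx /=.
by rewrite (inj_eq sg_inj) eq_sym.
Qed.

Let diag : seq ('I_d * 'I_n) := flatten [seq nseq p.-1 (m, sg m) | m <- enum 'I_d].

(** By M_step each block of p - 1 equal derivations trades
    det (M t) ^ (p - 1) for (p - 1)! det (M t.+1) ^ (p - 1). *)
Lemma D_det_pow : iter_deriv D diag (\det A ^+ p.-1) = p.-1`!%:R ^+ d.
Proof.
have M0 : M 0 = A by apply/matrixP => r l; rewrite mxE.
have Md : M d = 1%:M by apply/matrixP => r l; rewrite !mxE ltn_ord.
suff H t : (t <= d)%N ->
    iter_deriv D (flatten [seq nseq p.-1 (m, sg m) | m <- take t (enum 'I_d)])
      (\det A ^+ p.-1) = p.-1`!%:R ^+ t * \det (M t) ^+ p.-1.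
  have := H d (leqnn _); rewrite take_oversize ?size_enum_ord // => ->.
  by rewrite Md det1 expr1n mulr1.
elim: t => [|t IH] td; first by rewrite take0 /= M0 mul1r.
pose o := Ordinal td.
have to : nth o (enum 'I_d) t = o by have := nth_ord_enum o o.
rewrite (take_nth o) ?size_enum_ord // to map_rcons flatten_rcons iter_deriv_cat.
rewrite IH ?(ltnW td) //; have [D1 D2] := M_step o.
rewrite (iter_deriv_nseq derD _ _ D1 D2) ?exprS //.
by rewrite (derivX (derD _)) (deriv_nat (derD _)) mulr0.
Qed.

Lemma c_sg m : c (sg m) = x m.
Proof.
by rewrite /c (eq_bigl (pred1 m)) ?big_pred1_eq // => l /=; rewrite (inj_eq sg_inj).
Qed.

Lemma unzip1_diag : unzip1 diag = rows.
Proof.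
by rewrite /unzip1 map_flatten -map_comp; congr flatten; apply: eq_map => m /=;
  rewrite map_nseq.
Qed.

Lemma prod_diag : \prod_(j <- unzip2 diag) c j = \prod_m x m ^+ p.-1.
Proof.
rewrite /unzip2 map_flatten -map_comp big_flatten big_map big_enum /=.
apply: eq_bigr => m _; rewrite /= map_nseq big_nseq c_sg.
by elim: (p.-1) => //= q ->; rewrite exprS.
Qed.

Let sign1 k : (-1 : F) ^+ (k * p.-1) = 1.
Proof.
have -> : (-1 : F) ^+ (k * p.-1) = ((-1) ^+ p.-1) ^+ k by rewrite -exprM mulnC.
have [p2|podd] := even_prime p_prime.
  have -> : (-1 : F) = 1 by apply/eqP; rewrite eq_sym -addr_eq0 -mulr2n -p2 (pcharf0 charp).
  by rewrite !expr1n.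
move: podd; rewrite -{1}(prednK (prime_gt0 p_prime)) /= => /negbTE pe.
by rewrite -[(-1) ^+ p.-1]signr_odd pe !expr1n.
Qed.

Lemma size_diag : size diag = (d * p.-1)%N.
Proof. by rewrite -size_rows -unzip1_diag size_map. Qed.

(** The top differential operator sees a change of coordinates only through the
    (p - 1)-st power of its determinant. This value is read off by applying the
    diagonal word to delta = delta ^ p * det A ^ (p - 1), once directly and once
    through iter_deriv_good. *)
Lemma T_top : iter_deriv E rows (\prod_m x m ^+ p.-1) = (-1) ^+ d * delta ^+ p.-1.
Proof.
have d0 : delta != 0 by rewrite invr_eq0.
have p0 := prime_gt0 p_prime.
have dE : delta = delta ^+ p * \det A ^+ p.-1.
  by rewrite -{1}(prednK p0) exprS -mulrA -exprMn mulVf // expr1n mulr1.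
have := iter_deriv_good diag good1; rewrite mul1r mulr1 unzip1_diag prod_diag size_diag sign1 mul1r.
rewrite {1 2}dE.
rewrite (iter_deriv_pchar derD) // D_det_pow.
rewrite [\prod_m _ * _]mulrC -mulrA (iter_deriv_pchar derE) //.
rewrite (iter_deriv_const derE) => [|i]; last first.
  by rewrite (derivX (derE _)) (deriv_const_det (derE _)) ?mulr0 // => r m; rewrite mxE Ea.
move=> /(mulfI (expf_neq0 _ d0)) /(congr1 (fun y => delta ^+ p.-1 * y)).
rewrite mulrA -exprMn mulVf // expr1n mul1r => <-; rewrite mulrC.
have W : p.-1`!%:R = -1 :> F.
  apply/eqP; rewrite -addr_eq0 natr1; apply/eqP.
  have /dvdnP [q ->] : (p %| (p.-1`!).+1)%N by rewrite -Wilson // prime_gt1.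
  by rewrite natrM (pcharf0 charp) mulr0.
by rewrite W.
Qed.

(** The derivatives of x m form a row of the inverse of A, which is not 0. *)
Lemma x_neq0 m : x m != 0.
Proof.
apply/eqP => x0; have Bm i : B m i = 0 by rewrite -E_x x0 (deriv0 (derE _)).
have /matrixP /(_ m m) := mulVmx unitA; rewrite !mxE eqxx big1 => [/eqP|l _].
  by rewrite eq_sym oner_eq0.
by rewrite Bm mul0r.
Qed.

Lemma prod_c (N : 'I_n -> nat) : (forall j, N j != 0%N -> exists m, sg m = j) ->
  \prod_j c j ^+ N j = \prod_m x m ^+ N (sg m).
Proof.
move=> Nsg; have -> : \prod_m x m ^+ N (sg m) =
    \prod_m \prod_(j | sg m == j) x m ^+ N j.
  by apply: eq_bigr => m _; rewrite (eq_bigl (pred1 (sg m))) ?big_pred1_eq.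
rewrite (exchange_big_dep xpredT) //=; apply: eq_bigr => j _.
have [Nj|/Nsg [m <-]] := eqVneq (N j) 0%N; first by rewrite Nj big1.
rewrite c_sg (eq_bigl (pred1 m)) ?big_pred1_eq // => l /=.
by rewrite (inj_eq sg_inj).
Qed.

Definition facet_summand (N : 'X_{1..n}) : F :=
  delta * \prod_m (x m)^-1 * \prod_j c j ^+ N j.

Definition mdivp (N : 'X_{1..n}) : 'X_{1..n} := [multinom (N j %/ p)%N | j < n].

Lemma c_out j : (forall m, sg m != j) -> c j = 0.
Proof. by move=> sgj; rewrite /c big_pred0 // => m; apply/negbTE. Qed.

Lemma term_out (N : 'X_{1..n}) j : (forall m, sg m != j) -> N j != 0%N -> facet_summand N = 0.
Proof.
move=> sgj Nj; rewrite /facet_summand (bigD1 j) //= c_out // expr0n (negPf Nj).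
by rewrite mul0r mulr0.
Qed.

(** Up to p-th powers, which are constants, the summand is the monomial in the
    x m with exponents r m < p. If some r m is less than p - 1, its degree is less
    than the number d (p - 1) of derivatives, so that it is annihilated;
    otherwise p divides N and T_top applies. *)
Lemma T_term (N : 'X_{1..n}) : iter_deriv E rows (facet_summand N) =
  (-1) ^+ d * (if [forall j, (p %| N j)%N] then facet_summand (mdivp N) ^+ p else 0).
Proof.
have p0 := prime_gt0 p_prime.
have [/existsP [j /andP [Nj /forallP sgj]]|] :=
    boolP [exists j, (N j != 0%N) && [forall m, sg m != j]].
  rewrite (term_out sgj Nj) (iter_deriv0 derE); case: ifP => [/forallP pN|_]; last by rewrite mulr0.
  rewrite (term_out sgj); first by rewrite expr0n (gtn_eqF p0) mulr0.
  by rewrite mnmE -lt0n divn_gt0 // dvdn_leq // lt0n.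
rewrite negb_exists => /forallP Nsg.
have {}Nsg j : N j != 0%N -> exists m, sg m = j.
  move=> Nj; have := Nsg j; rewrite Nj /= negb_forall => /existsP [m].
  by rewrite negbK => /eqP ?; exists m.
pose q m := ((N (sg m) + p.-1) %/ p)%N; pose r m := ((N (sg m) + p.-1) %% p)%N.
(* 1 / x = x ^ (p - 1) / x ^ p makes every exponent nonnegative. *)
have tE : facet_summand N = (\prod_m (x m ^+ q m / x m)) ^+ p * (delta * \prod_m x m ^+ r m).
  rewrite /facet_summand prod_c // -prodrXl mulrCA -!mulrA; congr (_ * _).
  rewrite -!big_split /=; apply: eq_bigr => m _.
  have x0 := x_neq0 m; rewrite exprMn exprVn -exprM mulrAC -exprD -divn_eq exprD.
  by rewrite -{2}(prednK p0) exprSr; field; rewrite x0 expf_neq0.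
rewrite tE (iter_deriv_pchar derE) // (iter_deriv_const derE); last exact: E_delta.
have kx m : killed E 2 (x m) by move=> i i'; rewrite /= E_x E_B.
case: ifP => [/forallP pN|/negbT].
  have rE m : r m = p.-1.
    by rewrite /r -modnDml (eqP (pN _)) add0n modn_small // prednK.
  have qE m : q m = (N (sg m) %/ p)%N.
    by rewrite /q divnDl ?pN // [(p.-1 %/ p)%N]divn_small ?addn0 // prednK.
  under [X in iter_deriv _ _ X]eq_bigr do rewrite rE.
  rewrite T_top [delta * _]mulrCA -exprS prednK // mulrCA -exprMn; congr (_ * _ ^+ _).
  rewrite /facet_summand prod_c => [|j]; last first.
    by rewrite mnmE => Nj; apply: Nsg; apply: contraNneq Nj => ->; rewrite div0n.
  rewrite mulrC -mulrA -big_split; congr (_ * _); apply: eq_bigr => m _.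
  by rewrite qE mnmE mulrC.
rewrite negb_forall => /existsP [j pNj].
have [m sgm] : exists m, sg m = j by apply: Nsg; apply: contraNneq pNj => ->.
have rlt l : (r l <= p.-1)%N by rewrite -ltnS prednK // ltn_mod.
rewrite [iter_deriv _ _ _](@killed_iter_deriv _ _ E derE (\sum_m r m).+1) ?mulr0 //.
  by apply: killed_prod => // l; apply: killedX.
rewrite size_rows; have -> : (d * p.-1 = \sum_(l < d) p.-1)%N.
  by rewrite sum_nat_const card_ord.
rewrite (bigD1 m) //= [X in (_ <= X)%N](bigD1 m) //= -addSn leq_add //.
  rewrite ltn_neqAle rlt andbT; apply: contraNneq pNj => rp.
  rewrite -sgm -(dvdn_addl _ (dvdnn p)) -{2}(prednK p0) addnS /dvdn.
  by rewrite -addn1 -modnDml -/(r m) rp addn1 prednK // modnn.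
by apply: leq_sum => l _.
Qed.

Lemma D_term (w : seq ('I_d * 'I_n)) (N U : 'X_{1..n}) :
  unzip1 w = rows -> (forall j, U j = count_mem j (unzip2 w)) ->
  iter_deriv D w (facet_summand N) =
  (-1) ^+ d * (if [forall j, (p %| (N + U)%MM j)%N] then facet_summand (mdivp (N + U)) ^+ p else 0).
Proof.
move=> wr wU; rewrite -T_term.
have -> : facet_summand N = (\prod_m (x m)^-1 * \prod_j c j ^+ N j) * delta.
  by rewrite /facet_summand -mulrA mulrC.
rewrite iter_deriv_good; last first.
  apply: goodM; apply: good_prod => j; first exact/goodV/good_x.
  exact/goodX/good_c.
have -> : size w = (d * p.-1)%N by rewrite -size_rows -wr size_map.
rewrite wr sign1 mul1r; congr iter_deriv.
have -> : \prod_(j <- unzip2 w) c j = \prod_j c j ^+ U j.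
  rewrite (eq_bigr _ (fun j _ => congr1 (GRing.exp (c j)) (wU j))).
  elim: (unzip2 w) => [|i s IH]; first by rewrite big_nil big1.
  rewrite big_cons IH (bigD1 i) //= [RHS](bigD1 i) //= eqxx add1n exprS -mulrA.
  congr (_ * (_ * _)); apply: eq_bigr => j ji.
  by rewrite eq_sym (negPf ji).
rewrite /facet_summand mulrCA -big_split /= mulrC -mulrA; congr (_ * (_ * _)).
by apply: eq_bigr => j _; rewrite mnmDE addnC exprD.
Qed.

End FacetIdentity.

(** * Increasing enumerations of sets of vertices *)

Section EnumOrd.
Variable n : nat.
Implicit Types (S G : {set 'I_n}).

Lemma sorted_enum_set S : sorted (fun i j : 'I_n => (i < j)%N) (enum S).
Proof.
rewrite {1}/enum_mem -enumT; apply: sorted_filter => [j i l|]; first exact: ltn_trans.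
have -> : sorted (fun i j : 'I_n => (i < j)%N) (enum 'I_n) = sorted ltn (map val (enum 'I_n)).
  by rewrite sorted_map.
by rewrite val_enum_ord iota_ltn_sorted.
Qed.

Lemma index_enum_set S j : j \in S -> index j (enum S) = #|[set u in S | (u < j)%N]|.
Proof.
move=> jS; have -> : #|[set u in S | (u < j)%N]| = count (fun u : 'I_n => (u < j)%N) (enum S).
  rewrite -size_filter cardE; apply: perm_size; apply: uniq_perm.
  - exact: enum_uniq.
  - exact/filter_uniq/enum_uniq.
  by move=> u; rewrite [RHS]mem_filter !mem_enum inE andbC.
have := sorted_enum_set S; rewrite -mem_enum in jS.
elim: (enum S) jS => //= y s IH; rewrite inE => /orP jys ys.
have [yj|yj] := eqVneq y j.
  rewrite -yj ltnn; apply/esym/eqP; rewrite add0n -leqn0 leqNgt -has_count.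
  apply/hasPn => u us; rewrite -leqNgt ltnW //.
  have tr : transitive (fun i j : 'I_n => (i < j)%N) by move=> ? ? ?; apply: ltn_trans.
  exact: (allP (order_path_min tr ys)).
case: jys => [/eqP jy|js]; first by rewrite jy eqxx in yj.
rewrite IH //; last exact: path_sorted ys.
have tr : transitive (fun i j : 'I_n => (i < j)%N) by move=> ? ? ?; apply: ltn_trans.
by rewrite (allP (order_path_min tr ys)).
Qed.

(** Inserting j moves exactly the vertices after j by one place. *)
Lemma index_enum_setU1 G j u : j \notin G -> u \in G ->
  index u (enum (j |: G)) = bump #|[set w in G | (w < j)%N]| (index u (enum G)).
Proof.
move=> jG uG; rewrite !index_enum_set ?inE ?uG ?orbT // /bump.
have [uj|ju] := ltnP u j.
  have -> : [set w in j |: G | (w < u)%N] = [set w in G | (w < u)%N].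
    apply/setP => w; rewrite !inE; have [->|//] := eqVneq w j.
    by rewrite (negPf jG) ltnNge (ltnW uj).
  suff h : (#|[set w in G | (w < u)%N]| < #|[set w in G | (w < j)%N]|)%N.
    by rewrite leqNgt h.
  apply: proper_card; apply/properP; split.
    by apply/fintype.subsetP => w; rewrite !inE => /andP [-> wu]; apply: ltn_trans wu uj.
  by exists u; rewrite !inE uG // ltnn.
have {}ju : (j < u)%N.
  rewrite ltn_neqAle ju andbT; apply: contraNneq jG => ju'.
  by rewrite (val_inj ju').
have -> : [set w in j |: G | (w < u)%N] = j |: [set w in G | (w < u)%N].
  by apply/setP => w; rewrite !inE; have [->|] := eqVneq w j.
rewrite cardsU1 !inE (negPf jG) /= subset_leq_card //.
apply/fintype.subsetP => w; rewrite !inE => /andP [-> wj] /=; exact: ltn_trans wj ju.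
Qed.

End EnumOrd.


(** * The degree map as a sum over facets *)

Section Lee.
Variables (K F : fieldType) (phi : {rmorphism K -> F}) (n d : nat).
Variables (Dl : pure_complex n d) (aK : 'I_d -> 'I_n -> K) (v : 'I_d -> F).
Variable eps : {set 'I_n} -> bool.

Definition facet_mx (S : {set 'I_n}) : 'M[K]_d :=
  \matrix_(i, m) [seq aK i j | j <- enum S]`_m.
Definition facet_mxF (S : {set 'I_n}) : 'M[F]_d := map_mx phi (facet_mx S).
Definition facet_sol (S : {set 'I_n}) : 'cV[F]_d :=
  invmx (facet_mxF S) *m \col_i v i.
(** For j outside S the index is #|S| = d, so that the sum is empty. *)
Definition facet_pt (S : {set 'I_n}) (j : 'I_n) : F :=
  \sum_(m < d | index j (enum S) == m) facet_sol S m 0.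
Definition facet_wt (S : {set 'I_n}) : F :=
  (\det (facet_mxF S))^-1 * \prod_m (facet_sol S m 0)^-1.
(** Lee's formula: localization of the degree map at the facets. *)
Definition lee (f : {mpoly K[n]}) : F :=
  \sum_(S in facets Dl) (-1) ^+ eps S * (facet_wt S * mmap phi (facet_pt S) f).

Hypothesis det_neq0 : forall S : {set 'I_n}, #|S| = d -> \det (facet_mx S) != 0.
Hypothesis sol_neq0 : forall (S : {set 'I_n}) m, #|S| = d -> facet_sol S m 0 != 0.
Hypothesis oriented : forall G : {set 'I_n},
  \sum_(j | j \notin G) (-1) ^+ #|[set u in G | (u < j)%N]%SET| *
    (if (j |: G)%SET \in facets Dl then (-1) ^+ eps (j |: G)%SET else 0) = 0 :> F.

Section OneFacet.
Variables (S : {set 'I_n}) (hS : #|S| = d).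

Definition facet_col (m : 'I_d) : 'I_n := enum_val (cast_ord (esym hS) m).

Lemma facet_col_in m : facet_col m \in S. Proof. exact: enum_valP. Qed.

Lemma facet_col_inj : injective facet_col.
Proof. by move=> m l /enum_val_inj /cast_ord_inj. Qed.

Lemma index_facet_col m : index (facet_col m) (enum S) = m.
Proof.
rewrite /facet_col (enum_val_nth (enum_default (cast_ord (esym hS) m))).
by rewrite index_uniq ?enum_uniq //= -cardE hS ltn_ord.
Qed.

Lemma facet_col_surj j : j \in S -> exists m, facet_col m = j.
Proof.
move=> jS; have im : (index j (enum S) < d)%N by rewrite -hS cardE index_mem mem_enum.
exists (Ordinal im); rewrite /facet_col (enum_val_nth j) /=.
by rewrite nth_index // mem_enum.
Qed.

Lemma index_facet_colE j (m : 'I_d) : (index j (enum S) == m) = (facet_col m == j).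
Proof.
apply/eqP/eqP => [jm|<-]; last exact: index_facet_col.
have jS : j \in S.
  by rewrite -mem_enum -index_mem jm -cardE hS ltn_ord.
have [l lj] := facet_col_surj jS; rewrite -lj; congr facet_col.
by apply/val_inj; rewrite /= -jm -lj index_facet_col.
Qed.

Lemma facet_mxE i m : facet_mx S i m = aK i (facet_col m).
Proof.
rewrite mxE (nth_map (facet_col m)) -?cardE ?hS ?ltn_ord //.
by rewrite -{1}(index_facet_col m) nth_index // mem_enum facet_col_in.
Qed.

Lemma facet_mxF_unit : facet_mxF S \in unitmx.
Proof. by rewrite map_unitmx unitmxE unitfE det_neq0. Qed.

Lemma facet_solE : facet_mxF S *m facet_sol S = \col_i v i.
Proof. by rewrite mulmxA mulmxV ?facet_mxF_unit // mul1mx. Qed.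

Lemma facet_ptE j : facet_pt S j = \sum_(m | facet_col m == j) facet_sol S m 0.
Proof. by apply: eq_bigl => m; rewrite index_facet_colE. Qed.

Lemma facet_pt_col m : facet_pt S (facet_col m) = facet_sol S m 0.
Proof.
rewrite facet_ptE (eq_bigl (pred1 m)) ?big_pred1_eq // => l /=.
by rewrite (inj_eq facet_col_inj).
Qed.

Lemma facet_pt_out j : j \notin S -> facet_pt S j = 0.
Proof.
move=> jS; rewrite facet_ptE big_pred0 // => m; apply/negbTE.
by apply: contraNneq jS => <-; apply: facet_col_in.
Qed.

Lemma facet_pt_mu i : \sum_j phi (aK i j) * facet_pt S j = v i.
Proof.
have /matrixP /(_ i 0) := facet_solE; rewrite !mxE => <-.
under eq_bigr => j _ do rewrite facet_ptE mulr_sumr.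
rewrite (exchange_big_dep xpredT) //=; apply: eq_bigr => m _.
rewrite (eq_bigl (pred1 (facet_col m))) => [|j]; last by rewrite /= eq_sym.
by rewrite big_pred1_eq [in RHS]mxE facet_mxE.
Qed.

End OneFacet.

Definition mu_poly (i : 'I_d) : {mpoly K[n]} := \sum_(j < n) aK i j *: 'X_j.

Lemma leeZ c f : lee (c *: f) = phi c * lee f.
Proof. by rewrite /lee mulr_sumr; apply: eq_bigr => S _; rewrite mmapZ; ring. Qed.

Lemma lee_sum (I : Type) (r : seq I) (P : pred I) (f : I -> {mpoly K[n]}) :
  lee (\sum_(i <- r | P i) f i) = \sum_(i <- r | P i) lee (f i).
Proof.
rewrite /lee exchange_big /=; apply: eq_bigr => S _.
by rewrite raddf_sum !mulr_sumr.
Qed.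

Lemma facetS_card S : S \in facets Dl -> #|S| = d. Proof. exact: faces_pure. Qed.

Lemma lee_mu i f : lee (mu_poly i * f) = v i * lee f.
Proof.
rewrite /lee mulr_sumr; apply: eq_bigr => S /facetS_card hS.
rewrite rmorphM /= -(facet_pt_mu hS) raddf_sum /=.
under [X in X * mmap _ _ f]eq_bigr => j _ do rewrite mmapZ /= mmapX mmap1U.
ring.
Qed.

(** Multiplication by a linear combination of the mu_i. The vector la is chosen
    later so as to control which variables 'X_j occur. *)
Lemma lee_rel (la : 'I_d -> F) f :
  \sum_j (\sum_i la i * phi (aK i j)) * lee ('X_j * f) = (\sum_i la i * v i) * lee f.
Proof.
rewrite mulr_suml; under eq_bigr => j _ do rewrite mulr_suml.
rewrite exchange_big; apply: eq_bigr => i _ /=.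
rewrite -mulrA -lee_mu /mu_poly mulr_suml lee_sum mulr_sumr.
by apply: eq_bigr => j _; rewrite -scalerAl leeZ mulrA.
Qed.

Definition msuppset (N : 'X_{1..n}) : {set 'I_n} := [set j | N j != 0%N].

Lemma lee_nonface N : (forall S, S \in facets Dl -> ~~ (msuppset N \subset S)) ->
  lee 'X_[N] = 0.
Proof.
move=> NS; rewrite /lee big1 // => S SD.
have /subsetPn [j] := NS S SD; rewrite inE => Nj jS.
rewrite mmapX /mmap1 (bigD1 j) //= (facet_pt_out (facetS_card SD)) //.
by rewrite expr0n (negPf Nj) mul0r !mulr0.
Qed.

Lemma prod_ptE (S : {set 'I_n}) (hS : #|S| = d) :
  \prod_(j in S) facet_pt S j = \prod_m facet_sol S m 0.
Proof.
rewrite big_enum_val /= (reindex (cast_ord (esym hS))) /=.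
  by apply: eq_bigr => m _; rewrite -/(facet_col hS m) facet_pt_col.
by exists (cast_ord hS) => m _; rewrite ?cast_ordK ?cast_ordKV.
Qed.

Lemma mdeg_msupp_card N : (#|msuppset N| <= mdeg N)%N.
Proof.
rewrite mdegE -sum1_card big_mkcond /=; apply: leq_sum => j _.
by rewrite inE; case: (N j).
Qed.

Lemma squarefreeE N : (mdeg N <= #|msuppset N|)%N -> forall j, N j = (j \in msuppset N) :> nat.
Proof.
move=> Nle j; apply/eqP; rewrite inE; move: Nle; apply: contraTT => Nj.
have {}Nj : (1 < N j)%N by case: (N j) Nj => [|[]].
rewrite -ltnNge mdegE -sum1_card big_mkcond /= (bigD1 j) //= [X in (_ < X)%N](bigD1 j) //=.
rewrite inE -lt0n (ltn_trans _ Nj) // -addSn leq_add //.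
by apply: leq_sum => l _; rewrite inE; case: (N l).
Qed.

Lemma mmap1_squarefree (N : 'X_{1..n}) S : (forall j, N j = (j \in msuppset N) :> nat) ->
  mmap1 (facet_pt S) N = \prod_(j in msuppset N) facet_pt S j.
Proof.
move=> NE; rewrite /mmap1 [RHS]big_mkcond; apply: eq_bigr => j _.
by rewrite NE; case: (j \in _).
Qed.

(** The determinant with first column v and the vertices of the ridge G as its
    other columns, expanded along v. *)
Definition ridge_form (G : {set 'I_n}) : F :=
  \sum_(i < d) (-1) ^+ i * \det (\matrix_(r < d.-1, l < d.-1)
     phi [seq aK (lift i r) j | j <- enum G]`_l) * v i.

(** Cramer's rule: the sign is the position of j among the vertices of the
    facet, and what remains depends on G only. *)
Lemma ridge_formE (G : {set 'I_n}) (j : 'I_n) (hS : #|j |: G| = d) (m : 'I_d) :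
  j \notin G -> facet_col hS m = j ->
  \det (facet_mxF (j |: G)) * facet_sol (j |: G) m 0 =
  (-1) ^+ #|[set u in G | (u < j)%N]%SET| * ridge_form G.
Proof.
move=> jG mj; have um := facet_mxF_unit hS.
have mE : m = #|[set u in G | (u < j)%N]%SET| :> nat.
  rewrite -(index_facet_col hS m) mj index_enum_set ?inE ?eqxx //; congr #|pred_of_set _|.
  apply/setP => u; rewrite !inE; have [->|//] := eqVneq u j.
  by rewrite ltnn !andbF.
have cG : #|G| = d.-1 by rewrite -hS cardsU1 jG.
rewrite /facet_sol mxE mulr_sumr /ridge_form mulr_sumr; apply: eq_bigr => i _.
rewrite /invmx um !mxE. rewrite [LHS]mulrA [X in X * _]mulrA mulfV ?mul1r; last first.
  by rewrite -unitfE -unitmxE.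
rewrite /cofactor exprD -mE [(-1) ^+ i * _]mulrC !mulrA; congr (_ * \det _ * _).
apply/matrixP => r l; rewrite !mxE; congr (phi _); rewrite ?mxE.
have lG : (l < size (enum G))%N by rewrite -cardE cG.
pose u := nth j (enum G) l.
have uG : u \in G by rewrite -mem_enum mem_nth.
have uS : u \in enum (j |: G) by rewrite mem_enum !inE uG orbT.
have lS : (lift m l < size (enum (j |: G)))%N by rewrite -cardE hS ltn_ord.
transitivity (aK (lift i r) u); last by apply/esym; apply: nth_map.
rewrite (nth_map j _ _ lS); congr aK; rewrite /= -(nth_index j uS) index_enum_setU1 //.
by rewrite -mE /u index_uniq ?enum_uniq.
Qed.

(** All facets containing the ridge G contribute their sign divided by the same
    ridge_form G, so the sum is a multiple of the coefficient of G in the boundary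
    of the orientation cycle. *)
Lemma lee_ridge N : (#|msuppset N|.+1 = d)%N -> (mdeg N < d)%N -> lee 'X_[N] = 0.
Proof.
move GE: (msuppset N) => G cG; rewrite -cG ltnS -GE => /squarefreeE NE.
pose T S := (-1) ^+ eps S * (facet_wt S * mmap phi (facet_pt S) 'X_[N]).
have TE j : j \notin G -> j |: G \in facets Dl ->
    T (j |: G) = (ridge_form G)^-1 *
      ((-1) ^+ #|[set u in G | (u < j)%N]%SET| * (-1) ^+ eps (j |: G)).
  move=> jG jGf; have hS := facetS_card jGf; rewrite /T.
  rewrite [RHS]mulrA [RHS]mulrC; congr (_ * _).
  rewrite mmapX mmap1_squarefree // GE.
  have [m mj] : exists m, facet_col hS m = j by apply: facet_col_surj; rewrite !inE eqxx.
  have re := ridge_formE jG mj; have pj := facet_pt_col hS m; rewrite mj in pj.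
  have pE : \prod_m facet_sol (j |: G) m 0 =
      facet_sol (j |: G) m 0 * \prod_(u in G) facet_pt (j |: G) u.
    rewrite -(prod_ptE hS) (bigD1 j) ?inE ?eqxx //= pj; congr (_ * _).
    apply: eq_bigl => u; rewrite !inE; case: eqVneq => [->|] /=; first by rewrite (negPf jG).
    by rewrite andbT.
  have p0 : \prod_(u in G) facet_pt (j |: G) u != 0.
    have : \prod_m facet_sol (j |: G) m 0 != 0.
      by apply/prodf_neq0 => l _; apply: sol_neq0.
    by rewrite pE mulf_eq0 negb_or => /andP [].
  rewrite /facet_wt prodfV pE [(_ * \prod_(u in G) _)^-1]invfM mulrA mulfVK // -invfM re invfM.
  by rewrite invr_sign mulrC.
rewrite /lee -/(T _) (bigID (fun S : {set 'I_n} => G \subset S)) /=.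
rewrite [X in _ + X]big1 ?addr0 => [|S /andP [SD /fintype.subsetPn [j jG jS]]]; last first.
  rewrite mmapX /mmap1 (bigD1 j) //= (facet_pt_out (facetS_card SD)) //.
  by move: jG; rewrite -GE inE => Nj; rewrite expr0n (negPf Nj) mul0r !mulr0.
have -> : \sum_(S in facets Dl | G \subset S) T S =
   \sum_(S in [set j |: G | j in [set j | (j \notin G) && (j |: G \in facets Dl)]]) T S.
  apply: eq_bigl => S; apply/andP/imsetP => [[SD GS]|[j]].
    have : (0 < #|S :\: G|)%N.
      by rewrite cardsD (finset.setIidPr GS) subn_gt0 (facetS_card SD) -cG.
    case/card_gt0P => j; rewrite inE => /andP [jG jS].
    have SE : S = j |: G.
      apply/eqP; rewrite eq_sym eqEcard finset.subUset finset.sub1set jS GS /=.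
      by rewrite cardsU1 jG (facetS_card SD) -cG.
    by exists j => //; rewrite inE jG -SE.
  by rewrite inE => /andP [jG jGD] ->; rewrite jGD finset.subsetUr.
rewrite big_imset /=; last first.
  move=> j l; rewrite !inE => /andP [jG _] /andP [lG _] /setP /(_ j).
  by rewrite !inE eqxx /= (negPf jG) orbF => /esym/eqP.
rewrite (eq_bigr (fun j : 'I_n => (ridge_form G)^-1 *
    ((-1) ^+ #|[set u in G | (u < j)%N]%SET| * (-1) ^+ eps (j |: G)))) => [|j]; last first.
  by rewrite inE => /andP [jG jGD]; apply: TE.
rewrite -mulr_sumr; apply/eqP; rewrite mulf_eq0; apply/orP; right; apply/eqP.
rewrite -[RHS](oriented G); under eq_bigl => j do rewrite inE.
rewrite big_mkcondr /=.
by apply: eq_bigr => j _; case: ifP => _; rewrite ?mulr0.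
Qed.

Lemma msuppsetDU N j : msuppset (U_(j) + N)%MM = j |: msuppset N.
Proof.
apply/setP => l; rewrite !inE mnmDE mnm1E [j == l]eq_sym.
by rewrite addn_eq0 negb_and; case: (l == j).
Qed.

Lemma msuppset_subU (N : 'X_{1..n}) j : (1 < N j)%N -> msuppset (N - U_(j))%MM = msuppset N.
Proof.
move=> Nj; apply/setP => l; rewrite !inE mnmBE mnm1E.
have [<-|jl] := eqVneq j l; last by rewrite subn0.
by rewrite -!lt0n subn_gt0 Nj (ltn_trans _ Nj).
Qed.

Lemma mdeg_subU (N : 'X_{1..n}) j : (0 < N j)%N -> (mdeg (N - U_(j))%MM).+1 = mdeg N.
Proof.
move=> Nj; rewrite -[in RHS](submK (m := U_(j)%MM) (m' := N)) ?mdegD ?mdeg1 ?addn1 //.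
by apply/mnm_lepP => l; rewrite mnm1E; case: eqP => // <-.
Qed.

Lemma addU_subU (N : 'X_{1..n}) j : (0 < N j)%N -> (U_(j) + (N - U_(j)))%MM = N.
Proof.
move=> Nj; rewrite addmC submK //.
by apply/mnm_lepP => l; rewrite mnm1E; case: eqP => // <-.
Qed.

Lemma not_squarefree (N : 'X_{1..n}) : (#|msuppset N| < mdeg N)%N -> exists j, (1 < N j)%N.
Proof.
move=> lt; apply/existsP; apply: contraTT lt; rewrite negb_exists => /forallP N1.
rewrite -leqNgt mdegE -sum1_card [X in (_ <= X)%N]big_mkcond /=.
by apply: leq_sum => j _; have := N1 j; rewrite inE; case: (N j) => [|[]].
Qed.

Lemma inv_facet_mx (S : {set 'I_n}) (hS : #|S| = d) m l :
  \sum_i invmx (facet_mxF S) m i * phi (aK i (facet_col hS l)) = (m == l)%:R.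
Proof.
have /matrixP /(_ m l) := mulVmx (facet_mxF_unit hS); rewrite !mxE => <-.
by apply: eq_bigr => i _; rewrite [facet_mxF _ _ _]mxE (facet_mxE hS).
Qed.

Lemma inv_facet_v S m :
  \sum_i invmx (facet_mxF S) m i * v i = facet_sol S m 0.
Proof. by rewrite [RHS]mxE; apply: eq_bigr => i _; rewrite mxE. Qed.

Lemma face_or_not N : (forall S, S \in facets Dl -> ~~ (msuppset N \subset S)) \/
  exists2 S, S \in facets Dl & msuppset N \subset S.
Proof.
have [/existsP [S /andP [? ?]]|] := boolP [exists S in facets Dl, msuppset N \subset S].
  by right; exists S.
by rewrite negb_exists_in => /forall_inP ?; left.
Qed.

(** Induction on the codimension of the support G of N. A facet S containing G
    has a vertex m0 outside G, so the basis dual to its columns provides la with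
    prescribed values on G and at v. If a variable j is repeated in N, take
    la = 1 at j and 0 at v and at the rest of G: then lee_rel expresses the value
    by monomials of the same degree and larger support. If N is squarefree, take
    la = 0 on G and 1 at v: the value is expressed by monomials of degree one more
    and larger support. The recursion ends at ridges. *)
Lemma lee_low N : (mdeg N < d)%N -> lee 'X_[N] = 0.
Proof.
move: {-1}(d - #|msuppset N|)%N (leqnn (d - #|msuppset N|)) => s.
elim: s N => [|s IH] N Ns Nd.
  have := leq_ltn_trans (mdeg_msupp_card N) Nd.
  by rewrite -subn_gt0 lt0n -leqn0 Ns.
have [/lee_nonface //|[S SD GS]] := face_or_not N.
have hS := facetS_card SD; set G := msuppset N in GS *.
have Gd : (#|G| < d)%N := leq_ltn_trans (mdeg_msupp_card N) Nd.
have [Gd1|Gd1] := eqVneq #|G|.+1 d; first exact: lee_ridge.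
have {}Gd1 : (#|G|.+1 < d)%N by rewrite ltn_neqAle Gd1.
have [m0 m0G] : exists m0, facet_col hS m0 \notin G.
  have : (0 < #|S :\: G|)%N by rewrite cardsD (finset.setIidPr GS) subn_gt0 hS.
  case/card_gt0P => j; rewrite inE => /andP [jG jS].
  by have [m mj] := facet_col_surj hS jS; exists m; rewrite mj.
pose b m i := invmx (facet_mxF S) m i.
have x0 := sol_neq0 m0 hS.
have big_supp N' j : j \notin G -> msuppset N' = j |: G -> (mdeg N' < d)%N -> lee 'X_[N'] = 0.
  move=> jG N'E; apply: IH; rewrite N'E cardsU1 jG /= addnC subnDA.
  by rewrite leq_subLR add1n; apply: leq_trans Ns _.
have [/not_squarefree [j Nj]|Nle] := ltnP #|G| (mdeg N).
- have jG : j \in G by rewrite inE -lt0n ltnW.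
  have [m mj] := facet_col_surj hS (fintype.subsetP GS _ jG).
  pose la i := b m i - facet_sol S m 0 / facet_sol S m0 0 * b m0 i.
  have laE (f : 'I_d -> F) : \sum_i la i * f i =
      \sum_i b m i * f i - facet_sol S m 0 / facet_sol S m0 0 * \sum_i b m0 i * f i.
    by rewrite mulr_sumr -sumrB; apply: eq_bigr => i _; rewrite /la; ring.
  have := lee_rel la 'X_[(N - U_(j))].
  rewrite laE !inv_facet_v divfK // subrr mul0r (bigD1 j) //= -mpolyXD.
  rewrite addU_subU ?(ltnW Nj) // laE -{1 2}mj !inv_facet_mx eqxx.
  have -> : (m0 == m) = false by apply: contraNF m0G => /eqP ->; rewrite mj.
  rewrite mulr0 subr0 mul1r big1 ?addr0 // => l lj.
  rewrite -mpolyXD; have [lG|lG] := boolP (l \in G).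
    rewrite laE; have [m' m'l] := facet_col_surj hS (fintype.subsetP GS _ lG).
    rewrite -m'l !inv_facet_mx.
    have -> : (m0 == m') = false by apply: contraNF m0G => /eqP ->; rewrite m'l.
    have -> : (m == m') = false by apply: contraNF lj => /eqP mm; rewrite -m'l -mm mj.
    by rewrite mulr0 subr0 mul0r.
  rewrite (big_supp _ l) ?mulr0 //; first by rewrite msuppsetDU msuppset_subU.
  by rewrite mdegD mdeg1 add1n mdeg_subU // ltnW.
have Ndeg : mdeg N = #|G| by apply/eqP; rewrite eqn_leq Nle mdeg_msupp_card.
pose la i := b m0 i / facet_sol S m0 0.
have laE (f : 'I_d -> F) : \sum_i la i * f i = (\sum_i b m0 i * f i) / facet_sol S m0 0.
  by rewrite mulr_suml; apply: eq_bigr => i _; rewrite /la mulrAC.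
have := lee_rel la 'X_[N]; rewrite laE inv_facet_v mulfV // mul1r => <-.
apply: big1 => l _; rewrite -mpolyXD; have [lG|lG] := boolP (l \in G).
  rewrite laE; have [m' m'l] := facet_col_surj hS (fintype.subsetP GS _ lG).
  rewrite -m'l !inv_facet_mx.
  have -> : (m0 == m') = false by apply: contraNF m0G => /eqP ->; rewrite m'l.
  by rewrite !mul0r.
rewrite (big_supp _ l) ?mulr0 //; first by rewrite msuppsetDU.
by rewrite mdegD mdeg1 add1n Ndeg.
Qed.

Section Degree.
Variable degK : {mpoly K[n]} -> K.
Hypothesis degK_D : forall f g, degK (f + g) = degK f + degK g.
Hypothesis degK_Z : forall c f, degK (c *: f) = c * degK f.
Hypothesis degK_mu : forall i f, degK (mu_poly i * f) = 0.
Hypothesis degK_nonface : forall N : 'X_{1..n},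
  msuppset N \notin (Dl : {set {set 'I_n}}) -> degK 'X_[N] = 0.
Hypothesis degK_facet : forall S, S \in facets Dl ->
  degK (\prod_(j in S) 'X_j) = (-1) ^+ eps S / \det (facet_mx S).

Lemma degK_sum (I : Type) (r : seq I) (P : pred I) (f : I -> {mpoly K[n]}) :
  degK (\sum_(i <- r | P i) f i) = \sum_(i <- r | P i) degK (f i).
Proof.
apply: big_morph => //; apply: (addrI (degK 0)).
by rewrite -degK_D !addr0.
Qed.

Lemma degK_rel (la : 'I_d -> K) f :
  \sum_j (\sum_i la i * aK i j) * degK ('X_j * f) = 0.
Proof.
under eq_bigr => j _ do rewrite mulr_suml.
rewrite exchange_big big1 //= => i _.
transitivity (la i * degK (mu_poly i * f)); last by rewrite degK_mu mulr0.
rewrite /mu_poly mulr_suml degK_sum mulr_sumr.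
by apply: eq_bigr => j _; rewrite -scalerAl degK_Z mulrA.
Qed.

Lemma facetI S : S \in (Dl : {set {set 'I_n}}) -> #|S| = d -> S \in facets Dl.
Proof.
move=> SD hS; have [T mT ST] := @maxset_exists _ (mem (faces Dl)) _ SD.
have TD : T \in facets Dl by rewrite inE.
suff <- : T = S by [].
by apply/eqP; rewrite eq_sym eqEcard ST (facetS_card TD) hS /=.
Qed.

Lemma lee_degK_nonface N : msuppset N \notin (Dl : {set {set 'I_n}}) ->
  phi (degK 'X_[N]) = lee 'X_[N].
Proof.
move=> GD; rewrite degK_nonface // rmorph0 lee_nonface // => S SD.
apply: contra GD => GS; apply: facesS GS.
by move: SD; rewrite inE => /maxsetP [].
Qed.

Lemma lee_degK_facet N : mdeg N = d -> #|msuppset N| = d ->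
  phi (degK 'X_[N]) = lee 'X_[N].
Proof.
move=> Nd Gd; have [GD|/lee_degK_nonface //] :=
  boolP (msuppset N \in (Dl : {set {set 'I_n}})).
set G := msuppset N in GD Gd; have GF := facetI GD Gd.
have NE : forall j, N j = (j \in G) :> nat.
  by apply: squarefreeE; rewrite -/G Gd Nd.
have XE : 'X_[N] = \prod_(j in G) 'X_j :> {mpoly K[n]}.
  rewrite mpolyXE_id [RHS]big_mkcond; apply: eq_bigr => j _.
  by rewrite NE; case: (j \in G).
rewrite {1}XE degK_facet // fmorph_div rmorph_sign -det_map_mx.
rewrite /lee (bigD1 G) //= big1 ?addr0 => [|S /andP [SD SG]]; last first.
  have /fintype.subsetPn [j jG jS] : ~~ (G \subset S).
    apply: contra SG => GS; rewrite eq_sym eqEcard GS.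
    by rewrite (facetS_card SD) Gd leqnn.
  rewrite mmapX /mmap1 (bigD1 j) //= (facet_pt_out (facetS_card SD)) //.
  by rewrite NE jG mul0r !mulr0.
rewrite mmapX mmap1_squarefree // (prod_ptE Gd) /facet_wt prodfV mulfVK //.
by apply/prodf_neq0 => m _; apply: sol_neq0.
Qed.

(** Both sides satisfy the linear relations that replace a repeated variable
    by variables outside the support, because lee vanishes in degree d - 1; this
    reduces to monomials of facets. *)
Lemma lee_degK_monomial N : mdeg N = d -> phi (degK 'X_[N]) = lee 'X_[N].
Proof.
move: {-1}(d - #|msuppset N|)%N (leqnn (d - #|msuppset N|)) => s.
elim: s N => [|s IH] N Ns Nd; have [Gd|Gd] := eqVneq #|msuppset N| d;
    try exact: lee_degK_facet.
  case/eqP: Gd; apply/eqP; rewrite eqn_leq -{1}Nd mdeg_msupp_card.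
  by rewrite -subn_eq0 -leqn0.
have {}Gd : (#|msuppset N| < d)%N by rewrite ltn_neqAle Gd -Nd mdeg_msupp_card.
set G := msuppset N in Ns Gd *.
have [GD|/lee_degK_nonface //] := boolP (msuppset N \in (Dl : {set {set 'I_n}})).
have [S mS GS] := @maxset_exists _ (mem (faces Dl)) _ GD.
have SD : S \in facets Dl by rewrite inE.
have hS := facetS_card SD.
have [j Nj] : exists j, (1 < N j)%N by apply: not_squarefree; rewrite Nd.
have jG : j \in G by rewrite inE -lt0n ltnW.
have [m mj] := facet_col_surj hS (fintype.subsetP GS _ jG).
pose la i := invmx (facet_mx S) m i.
have laE l : \sum_i phi (la i) * phi (aK i (facet_col hS l)) = (m == l)%:R.
  rewrite -(inv_facet_mx hS); apply: eq_bigr => i _; congr (_ * _).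
  by rewrite /facet_mxF -map_invmx [in RHS]mxE.
pose ph l := \sum_i phi (la i) * phi (aK i l).
have phE l : phi (\sum_i la i * aK i l) = ph l.
  by rewrite rmorph_sum; apply: eq_bigr => i _; rewrite rmorphM.
have phj : ph j = 1 by rewrite /ph -mj laE eqxx.
have := lee_rel (fun i => phi (la i)) 'X_[(N - U_(j))].
rewrite [X in _ * X]lee_low ?mulr0; last by rewrite -ltnS mdeg_subU ?(ltnW Nj) ?Nd.
rewrite -/(ph _) (bigD1 j) //= -/(ph j) phj mul1r -mpolyXD addU_subU ?(ltnW Nj) // => e1.
have := congr1 phi (degK_rel la 'X_[(N - U_(j))]).
rewrite rmorph0 rmorph_sum (bigD1 j) //= rmorphM /= phE phj mul1r -mpolyXD.
rewrite addU_subU ?(ltnW Nj) // => e2.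
apply/esym/(addIr (\sum_(l | l != j) ph l * lee ('X_l * 'X_[(N - U_(j))]))).
rewrite [LHS]e1 -[LHS]e2; congr (_ + _); apply: eq_bigr => l lj.
rewrite rmorphM /= phE -mpolyXD; have [lG|lG] := boolP (l \in G).
  have [m' m'l] := facet_col_surj hS (fintype.subsetP GS _ lG).
  have -> : ph l = 0.
    rewrite /ph -m'l laE.
    by have -> : (m == m') = false by apply: contraNF lj => /eqP mm; rewrite -m'l -mm mj.
  by rewrite !mul0r.
congr (_ * _); apply: IH; last by rewrite mdegD mdeg1 add1n mdeg_subU // ltnW.
rewrite msuppsetDU msuppset_subU // cardsU1 lG /= addnC subnDA.
by rewrite leq_subLR add1n; apply: leq_trans Ns _.
Qed.

End Degree.

End Lee.

(** * The Frobenius identity for the degree map *)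

Section LeeFrobenius.
Variables (K F : fieldType) (phi : {rmorphism K -> F}) (n d p : nat).
Hypotheses (p_prime : prime p) (charp : p \in [pchar F]).
Variables (Dl : pure_complex n d) (aK : 'I_d -> 'I_n -> K) (v : 'I_d -> F).
Variable eps : {set 'I_n} -> bool.
Variables (D : 'I_d * 'I_n -> F -> F) (E : 'I_d -> F -> F).
Hypothesis derD : forall ij, derivation (D ij).
Hypothesis derE : forall i, derivation (E i).
Hypothesis commDE : forall ij i x, D ij (E i x) = E i (D ij x).
Hypothesis commEE : forall i i' x, E i (E i' x) = E i' (E i x).
Hypothesis Da : forall ij i j, D ij (phi (aK i j)) = (ij == (i, j))%:R.
Hypothesis Dv : forall ij i, D ij (v i) = 0.
Hypothesis Ea : forall i' i j, E i' (phi (aK i j)) = 0.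
Hypothesis Ev : forall i i', E i (v i') = (i == i')%:R.
Hypothesis det_neq0 : forall S : {set 'I_n}, #|S| = d -> \det (facet_mx aK S) != 0.

Lemma facet_mxF_col (S : {set 'I_n}) (hS : #|S| = d) :
  facet_mxF phi aK S = \matrix_(i, m) phi (aK i (facet_col hS m)).
Proof. by apply/matrixP => i m; rewrite mxE (facet_mxE aK hS) mxE. Qed.

Lemma facet_mxF_det (S : {set 'I_n}) (hS : #|S| = d) :
  \det (\matrix_(i, m) phi (aK i (facet_col hS m))) != 0.
Proof.
rewrite -facet_mxF_col -unitfE -unitmxE.
by rewrite map_unitmx unitmxE unitfE det_neq0.
Qed.

Lemma facet_solE_col (S : {set 'I_n}) (hS : #|S| = d) :
  \matrix_(i, m) phi (aK i (facet_col hS m)) *m facet_sol phi aK v S = \col_i v i.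
Proof. by rewrite -facet_mxF_col; apply: facet_solE. Qed.

Lemma facet_sol_neq0 (S : {set 'I_n}) m : #|S| = d -> facet_sol phi aK v S m 0 != 0.
Proof.
by move=> hS; apply: (x_neq0 derE Ea Ev (facet_mxF_det hS) (facet_solE_col hS)).
Qed.

Lemma facet_summandE (S : {set 'I_n}) (hS : #|S| = d) N :
  facet_wt phi aK v S * mmap phi (facet_pt phi aK v S) 'X_[N] =
  facet_summand (fun i j => phi (aK i j)) (facet_col hS) (facet_sol phi aK v S) N.
Proof.
rewrite /facet_wt /facet_summand mmapX facet_mxF_col; congr (_ * _).
by apply: eq_bigr => j _; rewrite (facet_ptE phi aK v hS).
Qed.

Lemma sign_pchar b : ((-1 : F) ^+ b) ^+ p = (-1) ^+ b.
Proof.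
rewrite exprAC; congr (_ ^+ _); have [p2|podd] := even_prime p_prime.
  have -> : (-1 : F) = 1 by apply/eqP; rewrite eq_sym -addr_eq0 -mulr2n -p2 (pcharf0 charp).
  by rewrite expr1n.
by rewrite -signr_odd podd expr1.
Qed.

(** The p-th power of the value of G at each facet is a constant for D, so D_term
    applies to every summand; the resulting p-th powers add up by Frobenius. *)
Lemma D_lee (w : seq ('I_d * 'I_n)) (N U : 'X_{1..n}) (G : {mpoly K[n]}) :
  unzip1 w = rows p d -> (forall j, U j = count_mem j (unzip2 w)) ->
  iter_deriv D w (lee phi Dl aK v eps (G ^+ p * 'X_[N])) =
  (-1) ^+ d * (if [forall j, (p %| (N + U)%MM j)%N]
               then lee phi Dl aK v eps (G * 'X_[mdivp p (N + U)]) ^+ p else 0).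
Proof.
move=> wr wU; pose tm S hS := facet_summand (fun i j => phi (aK i j)) (@facet_col n d S hS) (facet_sol phi aK v S).
pose g S := (-1) ^+ eps S * mmap phi (facet_pt phi aK v S) G.
have key (S : {set 'I_n}) (hS : #|S| = d) :
    iter_deriv D w ((-1) ^+ eps S * (facet_wt phi aK v S *
       mmap phi (facet_pt phi aK v S) (G ^+ p * 'X_[N]))) =
    g S ^+ p * iter_deriv D w (tm S hS N).
  rewrite -(iter_deriv_pchar derD) //; congr iter_deriv.
  rewrite rmorphM rmorphXn /= /tm -facet_summandE /g exprMn sign_pchar; ring.
have frob (f : {set 'I_n} -> F) : (\sum_(S in facets Dl) f S) ^+ p = \sum_(S in facets Dl) f S ^+ p.
  by rewrite -!(pFrobenius_autE charp) rmorph_sum.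
rewrite /lee (iter_deriv_sum derD) frob.
have -> (b : bool) (x : F) : (if b then x else 0) = b%:R * x.
  by case: b; rewrite ?mul1r ?mul0r.
rewrite mulrA mulr_sumr; apply: eq_bigr => S SD; have hS := facetS_card SD.
rewrite (key S hS) (D_term p_prime charp derD derE commDE commEE Da Dv Ea Ev
  (@facet_col_inj _ _ _ hS) (facet_mxF_det hS) (facet_solE_col hS) _ wr wU).
rewrite rmorphM /= [facet_wt _ _ _ _ * _]mulrCA facet_summandE /g !exprMn sign_pchar.
by case: [forall _, _] => /=; ring.
Qed.

End LeeFrobenius.

(** * The field of rational functions with a generic vector adjoined *)

Section GenericField.
Variables (k : fieldType) (n d : nat).
Local Notation K := (genK k n d).

Definition genF : fieldType := {fraction {mpoly K[d]}}.
Definition gen_phi : {rmorphism K -> genF} := (@tofrac {mpoly K[d]} \o @mpolyC d K).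
Definition gen_v (i : 'I_d) : genF := tofrac ('X_i : {mpoly K[d]}).
Definition gen_dK (ij : 'I_d * 'I_n) : K -> K :=
  frac_deriv (mderiv (mxvec_index ij.1 ij.2)).
Definition gen_D (ij : 'I_d * 'I_n) : genF -> genF := frac_deriv (coef_deriv (gen_dK ij)).
Definition gen_E (i : 'I_d) : genF -> genF := frac_deriv (mderiv i).

Lemma gen_dK_deriv ij : derivation (gen_dK ij).
Proof. exact/frac_deriv_derivation/mderiv_derivation. Qed.

Lemma gen_D_deriv ij : derivation (gen_D ij).
Proof. exact/frac_deriv_derivation/coef_deriv_derivation/gen_dK_deriv. Qed.

Lemma gen_E_deriv i : derivation (gen_E i).
Proof. exact/frac_deriv_derivation/mderiv_derivation. Qed.

Lemma gen_DE ij i x : gen_D ij (gen_E i x) = gen_E i (gen_D ij x).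
Proof.
apply: frac_deriv_comm; [|exact: mderiv_derivation|].
  exact/coef_deriv_derivation/gen_dK_deriv.
by move=> f; apply/coef_deriv_mderiv/gen_dK_deriv.
Qed.

Lemma gen_EE i i' x : gen_E i (gen_E i' x) = gen_E i' (gen_E i x).
Proof.
apply: frac_deriv_comm; try exact: mderiv_derivation.
by move=> f; apply: mderiv_comm.
Qed.

Lemma mderiv_var (R : idomainType) m (l l' : 'I_m) :
  mderiv l ('X_l' : {mpoly R[m]}) = (l == l')%:R.
Proof.
rewrite mderivX mnm1E eq_sym; case: eqVneq => [->|_]; last by rewrite scale0r.
rewrite scale1r (_ : (_ - _)%MM = 0%MM) ?mpolyX0 //.
by apply/mnmP => i; rewrite mnmBE subnn mnm0E.
Qed.

Lemma gen_Da ij i j : gen_D ij (gen_phi (gen_a k i j)) = (ij == (i, j))%:R.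
Proof.
rewrite /gen_D /= frac_deriv_tofrac; last exact/coef_deriv_derivation/gen_dK_deriv.
rewrite coef_derivC; last exact: gen_dK_deriv.
rewrite /gen_dK /gen_a frac_deriv_tofrac; last exact: mderiv_derivation.
rewrite mderiv_var !rmorph_nat; congr (nat_of_bool _)%:R.
by case: ij => i' j' /=; rewrite (inj_eq (@cast_ord_inj _ _ _)) (inj_eq enum_rank_inj).
Qed.

Lemma gen_Dv ij i : gen_D ij (gen_v i) = 0.
Proof.
rewrite /gen_D frac_deriv_tofrac; last exact/coef_deriv_derivation/gen_dK_deriv.
by rewrite coef_deriv_X ?rmorph0 //; apply: gen_dK_deriv.
Qed.

Lemma gen_Ea i' i j : gen_E i' (gen_phi (gen_a k i j)) = 0.
Proof.
rewrite /gen_E /= frac_deriv_tofrac; last exact: mderiv_derivation.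
by rewrite mderivC rmorph0.
Qed.

Lemma gen_Ev i i' : gen_E i (gen_v i') = (i == i')%:R.
Proof.
rewrite /gen_E frac_deriv_tofrac; last exact: mderiv_derivation.
by rewrite mderiv_var rmorph_nat.
Qed.

Lemma gen_det_neq0 (S : {set 'I_n}) : #|S| = d ->
  \det (facet_mx (@gen_a k n d) S) != 0.
Proof. exact: bracket_neq0. Qed.

Definition gen_iota : {rmorphism k -> genF} :=
  (gen_phi \o (@tofrac {mpoly k[d * n]} \o @mpolyC (d * n) k)).

Lemma gen_pchar p : p \in [pchar k] -> p \in [pchar genF].
Proof. exact: (rmorph_pchar gen_iota). Qed.

Lemma gen_oriented (D : pure_complex n d) eps : is_orientation k D eps ->
  forall G : {set 'I_n},
  \sum_(j | j \notin G) (-1) ^+ #|[set u in G | (u < j)%N]%SET| *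
    (if (j |: G)%SET \in facets D then (-1) ^+ eps (j |: G)%SET else 0) = 0 :> genF.
Proof.
move=> oD G; rewrite -[RHS](rmorph0 gen_iota) -(oD G).
rewrite /boundary rmorph_sum; apply: eq_bigr => j _.
rewrite rmorphM rmorph_sign; congr (_ * _).
by case: ifP => _; rewrite ?rmorph_sign ?rmorph0.
Qed.

Lemma gen_phi_eq0 x : (gen_phi x == 0) = (x == 0).
Proof. exact: fmorph_eq0. Qed.

End GenericField.


(** * The degree map on polynomials *)

Section Degree.
Variables (k : fieldType) (n d : nat) (D : pure_complex n d) (eps : {set 'I_n} -> bool).
Variable deg : degree_map k D eps.
Local Notation K := (genK k n d).
Implicit Types f g : {mpoly K[n]}.

Lemma toHZ c f : toH D (c *: f) = c *: toH D f.
Proof.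
rewrite /toH /toSR.
transitivity (\pi_{ideal_quot (@lsop_ideal k n d D)}%qT
   (c *: (\pi_{ideal_quot (SR_ideal (k:=k) D)}%qT f : SR_ring k D))).
  congr (\pi_ _)%qT; exact: pi_qscale.
exact: pi_qscale.
Qed.

Definition degf f : K := deg (toH D f).

Lemma degfD f g : degf (f + g) = degf f + degf g.
Proof. by rewrite /degf (rmorphD (toH D)) (raddfD deg). Qed.

Lemma degfZ c f : degf (c *: f) = c * degf f.
Proof. by rewrite /degf toHZ linearZ. Qed.

Lemma degf0 : degf 0 = 0.
Proof. by rewrite /degf (rmorph0 (toH D)) (raddf0 deg). Qed.

Lemma degf_mu i f : degf (mu_poly (@gen_a k n d) i * f) = 0.
Proof.
rewrite /degf (rmorphM (toH D)) /=.
suff -> : toH D (mu_poly (@gen_a k n d) i) = toH D 0.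
  by rewrite (rmorph0 (toH D)) mul0r (raddf0 deg).
apply/eqP; rewrite /toH -Quotient.idealrBE.
rewrite (rmorph0 (toSR D)) subr0; apply/asboolP.
exists [:: (1, mu k D i)]; rewrite big_seq1 mul1r; split=> // t.
by rewrite inE => /eqP ->; exists i.
Qed.

Lemma degf_nonface (N : 'X_{1..n}) :
  msuppset N \notin (D : {set {set 'I_n}}) -> degf 'X_[N] = 0.
Proof.
move=> GD; rewrite /degf.
suff e : @toSR k n d D 'X_[N] = toSR D 0.
  by rewrite /toH e -/(toH D 0) (rmorph0 (toH D)) (raddf0 deg).
apply/eqP; rewrite /toSR -Quotient.idealrBE subr0; apply/asboolP.
pose N1 : 'X_{1..n} := [multinom (N j).-1 | j < n].
exists [:: ('X_[N1], \prod_(j in msuppset N) 'X_j)]; split.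
  by move=> t; rewrite inE => /eqP ->; exists (msuppset N).
rewrite big_seq1 /= !mpolyXE_id [X in _ * X]big_mkcond -big_split /=.
apply: eq_bigr => j _; rewrite mnmE inE; case: (N j) => [|q] /=.
  by rewrite mulr1.
by rewrite exprSr.
Qed.

Lemma degf_facet S : S \in facets D ->
  degf (\prod_(j in S) 'X_j) = (-1) ^+ eps S / \det (facet_mx (@gen_a k n d) S).
Proof. exact: deg_facet. Qed.

Local Notation Lee := (lee (gen_phi k n d) D (@gen_a k n d) (@gen_v k n d) eps).

Lemma degf_lee f : is_orientation k D eps -> f \is d.-homog ->
  gen_phi k n d (degf f) = Lee f.
Proof.
move=> oD /dhomogP fd; rewrite [f]mpolyE lee_sum.
rewrite (big_morph degf degfD degf0) rmorph_sum big_seq [RHS]big_seq.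
apply: eq_bigr => m mf; rewrite degfZ rmorphM leeZ; congr (_ * _).
apply: (lee_degK_monomial (@gen_det_neq0 k n d) _ (gen_oriented oD) degfD degfZ
  degf_mu degf_nonface degf_facet); last exact: fd.
move=> S l; apply: facet_sol_neq0; try exact: gen_det_neq0.
- exact: gen_E_deriv.
- exact: gen_Ea.
- exact: gen_Ev.
Qed.

End Degree.

(** * Descent along Frobenius *)

Section Contents.
Variable n : nat.
Implicit Types (b : 'X_{1..n}) (s : seq 'I_n).

Definition content s : 'X_{1..n} := [multinom count_mem j s | j < n].

Lemma content_cat s s' : content (s ++ s') = (content s + content s')%MM.
Proof. by apply/mnmP => j; rewrite mnmDE !mnmE count_cat. Qed.

Lemma mdeg_content s : mdeg (content s) = size s.
Proof.
rewrite mdegE; under eq_bigr do rewrite mnmE.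
elim: s => [|i s IH] /=; first by rewrite big1.
rewrite big_split /= IH (bigD1 i) //= eqxx big1 ?add1n // => j ji.
by rewrite eq_sym (negPf ji).
Qed.

Lemma content_surj b : exists s, content s = b.
Proof.
exists (flatten [seq nseq (b j) j | j <- enum 'I_n]); apply/mnmP => j.
rewrite mnmE count_flatten sumnE 2!big_map big_enum /= (bigD1 j) //= big1 => [|i ij].
  by rewrite count_nseq /= eqxx mul1n addn0.
by rewrite count_nseq /= (negPf ij).
Qed.

(** If M > 0, take for f0 the constant word at a variable dividing b. A word of
    length M < p that agrees with it modulo p uses no other variable, since an
    exponent between 1 and M is not divisible by p. *)
Lemma rigid_word p M b : (M < p)%N -> ((0 < M)%N -> (0 < mdeg b)%N) ->
  exists2 f0 : {ffun 'I_M -> 'I_n},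
    ((\sum_i U_(f0 i))%MM <= [multinom (p * b j)%N | j < n])%MM &
    forall f : {ffun 'I_M -> 'I_n},
      (forall j, (p %| (\sum_i U_(f i))%MM j +
                   (p * b j - (\sum_i U_(f0 i))%MM j))%N) -> f = f0.
Proof.
case: M => [|M] Mp bpos.
  have emp (i : 'I_0) : 'I_n by case: i.
  exists [ffun i => emp i] => [|f _]; last by apply/ffunP; case.
  by apply/mnm_lepP => j; rewrite big_ord0 mnm0E.
have [j bj] : exists j, (0 < b j)%N.
  apply/existsP; apply: contraTT (bpos isT); rewrite negb_exists => /forallP b0.
  rewrite -leqNgt mdegE leqn0 sum_nat_eq0; apply/forallP => j.
  by have := b0 j; rewrite -leqNgt leqn0.
have cst l : (\sum_(i < M.+1) U_([ffun=> j] i))%MM l = (M.+1 * (j == l))%N.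
  rewrite mnm_sumE; under eq_bigr do rewrite ffunE mnm1E.
  by rewrite sum_nat_const card_ord.
exists [ffun=> j] => [|f fp].
  apply/mnm_lepP => l; rewrite cst mnmE; case: eqP => [<-|_]; last by rewrite muln0.
  by rewrite muln1 (leq_trans (ltnW Mp)) // leq_pmulr.
apply/ffunP => i; rewrite ffunE; apply/eqP; apply: contraT => fij.
have := fp (f i); rewrite cst eq_sym (negPf fij) muln0 subn0 dvdn_addl ?dvdn_mulr //.
rewrite mnm_sumE (bigD1 i) //= mnm1E eqxx => /dvdn_leq /= -/(_ isT).
rewrite leqNgt => /negP []; apply: leq_ltn_trans Mp.
rewrite add1n ltnS; apply: (@leq_trans (\sum_(l < M.+1 | l != i) 1)).
  by apply: leq_sum => l _; rewrite mnm1E; case: (_ == _).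
by rewrite sum1_card cardC1 card_ord.
Qed.

End Contents.

Section Descent.
Variables (k : fieldType) (n d p : nat) (D : pure_complex n d).
Variable eps : {set 'I_n} -> bool.
Variable deg : degree_map k D eps.
Hypotheses (p_prime : prime p) (char_k : p \in [pchar k]).
Hypothesis D_oriented : is_orientation k D eps.
Local Notation K := (genK k n d).
Local Notation Lee := (lee (gen_phi k n d) D (@gen_a k n d) (@gen_v k n d) eps).

Definition ell_poly : {mpoly K[n]} := \sum_(j < n) 'X_j.

Lemma ell_polyX M :
  ell_poly ^+ M = \sum_(f : {ffun 'I_M -> 'I_n}) 'X_[\sum_i U_(f i)].
Proof.
rewrite -[M in LHS]card_ord -prodr_const bigA_distr_bigA /=.
by apply: eq_bigr => f _; rewrite (big_morph _ (@mpolyXD n K) (@mpolyX0 n K)).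
Qed.

Lemma ell_poly_homog M : ell_poly ^+ M \is M.-homog.
Proof.
rewrite -{2}[M]mul1n; apply: dhomogMn; apply: rpred_sum => j _.
by rewrite dhomogX; apply/eqP; exact: mdeg1.
Qed.

(** Write p b = m0 + N + U with m0 the content of the rigid word f0. Expanding the
    power of ell_poly and applying to the hypothesis at N an operator with column
    monomial U, only the word f0 contributes, and it contributes the p-th power
    of the degree of G * 'X_[b]. *)
Lemma frobenius_descent (G : {mpoly K[n]}) e M :
  G \is e.-homog -> (M < p)%N -> (p * e + M <= d)%N ->
  (forall N, (p * e + M + mdeg N = d)%N ->
     degf deg (G ^+ p * ell_poly ^+ M * 'X_[N]) = 0) ->
  forall b, (e + mdeg b = d)%N -> degf deg (G * 'X_[b]) = 0.
Proof.
move=> Ge Mp eM G0 b eb; have p0 := prime_gt0 p_prime.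
have bpos : (0 < M)%N -> (0 < mdeg b)%N.
  move=> M0; rewrite -(ltn_add2l e) addn0 eb; apply: leq_trans eM.
  by rewrite -addn1 leq_add // leq_pmull.
have [f0 f0b f0E] := rigid_word Mp bpos.
set m0 := (\sum_i U_(f0 i))%MM in f0b f0E.
pose pb : 'X_{1..n} := [multinom (p * b j)%N | j < n].
have [s sE] := content_surj (pb - m0)%MM.
have m0deg : mdeg m0 = M.
  rewrite /m0 mdeg_sum; under eq_bigr do rewrite mdeg1.
  by rewrite sum1_card card_ord.
have pbdeg : mdeg pb = (p * mdeg b)%N.
  by rewrite !mdegE big_distrr; apply: eq_bigr => j _; rewrite mnmE.
have ssize : (size s + M = p * mdeg b)%N.
  by rewrite -mdeg_content sE -m0deg -mdegD submK.
pose r := (d - (p * e + M))%N.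
pose s1 := take r s; pose s2 := drop r s.
have sz : size s = (r + d * p.-1)%N.
  apply/eqP; rewrite -(eqn_add2r (p * e + M)) addnAC [(r + _)%N]subnK //.
  rewrite -mulnS prednK // addnCA ssize -mulnDr eb; apply/eqP; exact: mulnC.
have s2size : size s2 = (d * p.-1)%N by rewrite size_drop sz addKn.
have s1size : size s1 = r by rewrite size_takel // sz leq_addr.
pose w := zip (rows p d) s2.
have w1 : unzip1 w = rows p d by rewrite unzip1_zip // size_rows s2size.
have w2 : unzip2 w = s2 by rewrite unzip2_zip // size_rows s2size.
have w2E j : content s2 j = count_mem j (unzip2 w) by rewrite w2 mnmE.
have := G0 (content s1); rewrite mdeg_content s1size /r subnKC // => /(_ erefl).
have hom : G ^+ p * ell_poly ^+ M * 'X_[content s1] \is d.-homog.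
  have dE : (e * p + M + mdeg (content s1))%N = d.
    by rewrite mdeg_content s1size /r mulnC subnKC.
  rewrite -[X in X.-homog]dE; apply: dhomogM; last by rewrite dhomogX.
  apply: dhomogM; [exact: dhomogMn | exact: ell_poly_homog].
move/(congr1 (gen_phi k n d)); rewrite rmorph0 degf_lee //.
rewrite ell_polyX mulr_sumr mulr_suml lee_sum.
move/(congr1 (iter_deriv (@gen_D k n d) w)).
rewrite (iter_deriv0 (@gen_D_deriv k n d)) (iter_deriv_sum (@gen_D_deriv k n d)).
have step (f : {ffun 'I_M -> 'I_n}) :
  iter_deriv (@gen_D k n d) w (Lee (G ^+ p * 'X_[\sum_i U_(f i)] * 'X_[content s1])) =
  (if f == f0 then (-1) ^+ d * Lee (G * 'X_[b]) ^+ p else 0).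
  rewrite -mulrA -mpolyXD.
  rewrite (D_lee p_prime (gen_pchar n d char_k) D eps (@gen_D_deriv k n d) (@gen_E_deriv k n d)
    (@gen_DE k n d) (@gen_EE k n d) (@gen_Da k n d) (@gen_Dv k n d) (@gen_Ea k n d)
    (@gen_Ev k n d) (@gen_det_neq0 k n d) _ _ w1 w2E).
  rewrite -addmA -content_cat cat_take_drop sE.
  have [->|ff0] := eqVneq f f0.
    rewrite -/m0 addmC submK //.
    have -> : [forall j, (p %| pb j)%N] by apply/forallP => j; rewrite mnmE dvdn_mulr.
    have -> // : mdivp p pb = b.
    by apply/mnmP => j; rewrite !mnmE mulKn.
  case: ifP => [/forallP pf|_]; last by rewrite mulr0.
  case/eqP: ff0; apply: f0E => j; have := pf j.
  by rewrite mnmDE mnmBE mnmE.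
rewrite (eq_bigr _ (fun f _ => step f)) -big_mkcond big_pred1_eq => /eqP.
rewrite mulf_eq0 signr_eq0 expf_eq0 p0 /= -(degf_lee deg) //; last first.
  by rewrite -[X in X.-homog]eb; apply: dhomogM; rewrite ?dhomogX.
by rewrite gen_phi_eq0 => /eqP.
Qed.

End Descent.

(** * Dimensions of subspaces *)

Section Dimension.
Variables (F : fieldType) (V : lmodType F).
Implicit Types (U : set V).

Definition lin_comb r (b : 'I_r -> V) (v : V) : Prop :=
  exists c : 'I_r -> F, v = \sum_i c i *: b i.

Lemma lin_combD r (b : 'I_r -> V) u v :
  lin_comb b u -> lin_comb b v -> lin_comb b (u + v).
Proof.
move=> [c ->] [e ->]; exists (fun i => c i + e i); rewrite -big_split.
by apply: eq_bigr => i _; rewrite scalerDl.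
Qed.

Lemma lin_combZ r (b : 'I_r -> V) a v : lin_comb b v -> lin_comb b (a *: v).
Proof.
move=> [c ->]; exists (fun i => a * c i); rewrite scaler_sumr.
by apply: eq_bigr => i _; rewrite scalerA.
Qed.

Lemma lin_comb_sum r (b : 'I_r -> V) (I : Type) (s : seq I) (f : I -> V) :
  (forall i, lin_comb b (f i)) -> lin_comb b (\sum_(i <- s) f i).
Proof.
move=> bf; elim/big_rec: _ => [|i v _ bv]; last exact: lin_combD.
by exists (fun=> 0); rewrite big1 // => i _; rewrite scale0r.
Qed.

Lemma basis_of_span (s : seq V) : exists r (b : 'I_r -> V),
  [/\ forall i, b i \in s,
      forall c : 'I_r -> F, \sum_i c i *: b i = 0 -> forall i, c i = 0 &
      forall v, v \in s -> lin_comb b v].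
Proof.
elim: s => [|v s [r [b [bs bfree bspan]]]].
  by exists 0%N, (fun=> 0); split=> [[]|? _ []|].
have [bv|bv] := pselect (lin_comb b v).
  exists r, b; split=> // [i|u]; first by rewrite inE bs orbT.
  by rewrite inE => /orP [/eqP -> //|/bspan].
pose b' (i : 'I_r.+1) := if unlift ord0 i is Some j then b j else v.
have b'E (c : 'I_r.+1 -> F) :
    \sum_i c i *: b' i = c ord0 *: v + \sum_i c (lift ord0 i) *: b i.
  rewrite big_ord_recl /b' unlift_none; congr (_ + _).
  by apply: eq_bigr => i _; rewrite liftK.
exists r.+1, b'; split=> [i|c|u].
- by rewrite /b' inE; case: unliftP => [j _|_]; rewrite ?bs ?eqxx ?orbT.
- rewrite b'E => e.
  have c0 : c ord0 = 0.
    apply/eqP; apply: contra_notT bv => c0; exists (fun i => - (c ord0)^-1 * c (lift ord0 i)).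
    move/eqP: e; rewrite addr_eq0 => /eqP /(congr1 (fun x => (c ord0)^-1 *: x)).
    rewrite scalerA mulVf // scale1r => ->; rewrite scalerN scaler_sumr -sumrN.
    by apply: eq_bigr => i _; rewrite scalerA mulNr scaleNr.
  move: e; rewrite c0 scale0r add0r => /bfree cl i.
  by case: (unliftP ord0 i) => [j|] ->.
- rewrite inE => /orP [/eqP ->|/bspan [c ->]].
    exists (fun i => (i == ord0)%:R); rewrite b'E eqxx scale1r big1 ?addr0 // => i _.
    by rewrite scale0r.
  exists (fun i => if unlift ord0 i is Some j then c j else 0).
  rewrite b'E unlift_none scale0r add0r; apply: eq_bigr => i _.
  by rewrite liftK.
Qed.

Lemma has_dim_span U (s : seq V) : (forall v, v \in s -> U v) ->
  (forall r (b : 'I_r -> V) v, (forall u, u \in s -> lin_comb b u) -> U v -> lin_comb b v) ->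
  exists r, has_dim U r.
Proof.
move=> sU Us; have [r [b [bs bfree bspan]]] := basis_of_span s.
by exists r, b; split=> // [i|v Uv]; [apply: sU | apply: Us Uv].
Qed.

(** Let the rows of M hold the coordinates of the images of a basis. If r > r',
    a nonzero row vector u with u M = 0 is a linear relation between these
    images, hence between the basis vectors. *)
Lemma has_dim_le U U' r r' (f : V -> V) :
  (forall r (b : 'I_r -> V), (forall i, U (b i)) ->
     forall c : 'I_r -> F, U (\sum_i c i *: b i)) ->
  (forall u v, f (u + v) = f u + f v) -> (forall c u, f (c *: u) = c *: f u) ->
  (forall u, U u -> U' (f u)) -> (forall u, U u -> f u = 0 -> u = 0) ->
  has_dim U r -> has_dim U' r' -> (r <= r')%N.
Proof.
move=> Ulin fD fZ fU finj [b [bU bfree _]] [b' [_ _ b'span]].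
have [M ME] : exists M : 'M[F]_(r, r'), forall i, f (b i) = \sum_j M i j *: b' j.
  have [c cE] := boolp.choice (fun i => b'span _ (fU _ (bU i))).
  by exists (\matrix_(i, j) c i j) => i; rewrite cE; apply: eq_bigr => j _; rewrite mxE.
have f0 : f 0 = 0 by apply: (addrI (f 0)); rewrite -fD !addr0.
rewrite leqNgt; apply/negP => r'r.
have : kermx M != 0.
  rewrite kermx_eq0; apply/negP => /eqP rM.
  by have := rank_leq_col M; rewrite rM leqNgt r'r.
case/rowV0Pn => u uM /eqP []; apply/rowP => i; rewrite mxE.
apply: (bfree (fun i => u 0 i)); apply: finj; first exact: Ulin.
rewrite (big_morph f fD f0).
under eq_bigr => j _ do rewrite fZ ME scaler_sumr.
rewrite exchange_big big1 // => j _ /=.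
under eq_bigr => l _ do rewrite scalerA.
rewrite -scaler_suml; have /matrixP /(_ 0 j) : u *m M = 0 by apply/sub_kermxP.
by rewrite !mxE => ->; rewrite scale0r.
Qed.

End Dimension.


(** * The Gorenstein quotient *)

Section Gorenstein.
Variables (k : fieldType) (n d : nat) (D : pure_complex n d).
Variable eps : {set 'I_n} -> bool.
Variable deg : degree_map k D eps.
Local Notation K := (genK k n d).

Definition Hpoly (f : {mpoly K[n]}) : Hbar deg := toHbar deg (toH D f).

Lemma HpolyB f g : Hpoly (f - g) = Hpoly f - Hpoly g.
Proof.
rewrite /Hpoly (rmorphB (toH D)) /toHbar.
exact: (rmorphB (\pi_{ideal_quot (gorenstein_ideal deg)}%qT)).
Qed.

Lemma HpolyM f g : Hpoly (f * g) = Hpoly f * Hpoly g.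
Proof.
rewrite /Hpoly (rmorphM (toH D)) /toHbar.
exact: (rmorphM (\pi_{ideal_quot (gorenstein_ideal deg)}%qT)).
Qed.

Lemma Hpoly1 : Hpoly 1 = 1.
Proof.
rewrite /Hpoly (rmorph1 (toH D)) /toHbar.
exact: (rmorph1 (\pi_{ideal_quot (gorenstein_ideal deg)}%qT)).
Qed.

Lemma HpolyZ c f : Hpoly (c *: f) = c *: Hpoly f.
Proof. by rewrite /Hpoly toHZ /toHbar; apply: pi_qscale. Qed.

Lemma Hpoly0 : Hpoly 0 = 0.
Proof. by have := HpolyB 0 0; rewrite !subrr. Qed.

Lemma HpolyD f g : Hpoly (f + g) = Hpoly f + Hpoly g.
Proof.
have := HpolyB f (- g); rewrite opprK => ->.
by have := HpolyB 0 g; rewrite Hpoly0 !sub0r => ->; rewrite opprK.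
Qed.

Lemma HpolyX f m : Hpoly (f ^+ m) = Hpoly f ^+ m.
Proof. by elim: m => [|m IH]; rewrite ?Hpoly1 // !exprS HpolyM IH. Qed.

Lemma Hpoly_ell : Hpoly (ell_poly k n d) = ell deg. Proof. by []. Qed.

Lemma Hbar_grP m (g : Hbar deg) :
  Hbar_gr deg m g <-> exists2 f : {mpoly K[n]}, f \is m.-homog & g = Hpoly f.
Proof.
split=> [[_ [f fm <-] <-]|[f fm ->]]; first by exists f.
by exists (toH D f) => //; exists f.
Qed.

(** An element of the kernel in degree m, times an element of degree d - e, either
    has degree d and pairs to 0 by definition, or lies in a degree where the
    degree map is 0. *)
Lemma Hpoly_eq0 e f : f \is e.-homog ->
  Hpoly f = 0 <-> forall N, (e + mdeg N = d)%N -> degf deg (f * 'X_[N]) = 0.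
Proof.
move=> fe; have memE : (Hpoly f = 0) <-> (toH D f \in gorenstein_ideal deg).
  rewrite -[toH D f]subr0 (Quotient.idealrBE (gorenstein_ideal deg)).
  by rewrite /Hpoly /toHbar; split=> [h|/eqP h]; [apply/eqP|];
    rewrite h ?(raddf0 (\pi_{ideal_quot (gorenstein_ideal deg)}%qT)).
rewrite memE; split=> [/asboolP [s [sK fs]] N eN|f0].
  rewrite /degf (rmorphM (toH D)) /= fs mulr_suml (raddf_sum deg) big_seq big1 // => u us.
  have [m [um uK]] := sK _ us.
  have XN : H_gr (mdeg N) (@toH k n d D 'X_[N]) by exists 'X_[N]; rewrite //= dhomogX.
  have [mN|/eqP mN] := eqVneq (m + mdeg N)%N d; first exact: uK mN XN.
  exact: deg_off mN (H_grM um XN).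
apply/asboolP; exists [:: toH D f]; rewrite big_seq1; split=> // u.
rewrite inE => /eqP ->; exists e; split=> [|e' _ ee' [h he <-]]; first by exists f.
rewrite -(rmorphM (toH D)) -/(degf deg _) [h]mpolyE mulr_sumr.
rewrite (big_morph _ (@degfD _ _ _ _ _ deg) (@degf0 _ _ _ _ _ deg)) big_seq big1 // => m mh.
rewrite -scalerAr degfZ f0 ?mulr0 //.
have /dhomogP he' : h \is e'.-homog by exact: he.
by rewrite -ee'; congr addn; apply: he'.
Qed.

(** With M = p q + r, the product g ^ p ell ^ M is (g ell ^ q) ^ p ell ^ r. *)
Lemma Hbar_descent p m M (g : Hbar deg) : prime p -> p \in [pchar k] ->
  is_orientation k D eps -> Hbar_gr deg m g -> (p * m + M <= d)%N ->
  g ^+ p * ell deg ^+ M = 0 -> g * ell deg ^+ (M %/ p) = 0.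
Proof.
move=> p_prime char_k oD /Hbar_grP [f fm ->] mM.
set q := (M %/ p)%N; set r := (M %% p)%N.
have Mqr : (p * (m + q) + r = p * m + M)%N.
  by rewrite mulnDr -addnA [(p * q)%N]mulnC -divn_eq.
have Ge : f * ell_poly k n d ^+ q \is (m + q).-homog.
  exact/dhomogM/ell_poly_homog.
rewrite -Hpoly_ell -!HpolyX -!HpolyM => H0; apply/(Hpoly_eq0 Ge).
have E : f ^+ p * ell_poly k n d ^+ M =
    (f * ell_poly k n d ^+ q) ^+ p * ell_poly k n d ^+ r.
  by rewrite exprMn -mulrA -exprM -exprD -divn_eq.
have hom : f ^+ p * ell_poly k n d ^+ M \is (p * m + M).-homog.
  apply: dhomogM; last exact: ell_poly_homog.
  by rewrite mulnC; apply: dhomogMn.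
apply: (@frobenius_descent k n d p D eps deg p_prime char_k oD _ _ r Ge).
- by rewrite ltn_mod prime_gt0.
- by rewrite Mqr.
by move=> N; rewrite Mqr -E => Nd; move/(Hpoly_eq0 hom): H0; apply.
Qed.

Lemma Hbar_gr_ell m M (g : Hbar deg) : Hbar_gr deg m g -> Hbar_gr deg (m + M) (ell deg ^+ M * g).
Proof.
move=> /Hbar_grP [f fm ->]; apply/Hbar_grP; exists (f * ell_poly k n d ^+ M).
  exact/dhomogM/ell_poly_homog.
by rewrite -Hpoly_ell HpolyM HpolyX mulrC.
Qed.

Lemma Hbar_grB m (g h : Hbar deg) : Hbar_gr deg m g -> Hbar_gr deg m h -> Hbar_gr deg m (g - h).
Proof.
move=> /Hbar_grP [f fm ->] /Hbar_grP [f' fm' ->]; apply/Hbar_grP.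
by exists (f - f'); rewrite ?HpolyB // rpredB.
Qed.

Lemma Hbar_gr_lin m r (b : 'I_r -> Hbar deg) : (forall i, Hbar_gr deg m (b i)) ->
  forall c : 'I_r -> K, Hbar_gr deg m (\sum_i c i *: b i).
Proof.
move=> bm c; apply/Hbar_grP.
have /boolp.choice [f fE] i : exists f : {mpoly K[n]}, f \is m.-homog /\ b i = Hpoly f.
  by have /Hbar_grP [f fm bf] := bm i; exists f.
exists (\sum_i c i *: f i); first by apply: rpred_sum => i _; apply/rpredZ/(fE i).1.
rewrite (big_morph Hpoly HpolyD Hpoly0); apply: eq_bigr => i _.
by rewrite HpolyZ -(fE i).2.
Qed.

Lemma Hbar_gr_dim m : exists r, has_dim (Hbar_gr deg m) r.
Proof.
pose s := [seq Hpoly 'X_[bmnm N] | N <- enum [pred N : 'X_{1..n < m.+1} | mdeg (bmnm N) == m]].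
apply: (has_dim_span (s := s)).
  move=> v /mapP [N]; rewrite mem_enum => Nm ->.
  by apply/Hbar_grP; exists 'X_[bmnm N]; rewrite // dhomogX.
move=> r b v sb /Hbar_grP [f /dhomogP fm ->].
rewrite [f]mpolyE (big_morph Hpoly HpolyD Hpoly0) big_seq big_mkcond /=.
apply: lin_comb_sum => N; case: ifP => Nf; last first.
  by exists (fun=> 0); rewrite big1 // => i _; rewrite scale0r.
rewrite HpolyZ; apply/lin_combZ/sb/mapP.
have Nm : mdeg N = m by exact: fm.
have Nlt : (mdeg N < m.+1)%N by rewrite Nm.
by exists (BMultinom Nlt) => //; rewrite mem_enum inE /= Nm eqxx.
Qed.

End Gorenstein.

Section Injectivity.
Variables (k : fieldType) (n d p : nat) (D : pure_complex n d).
Variable eps : {set 'I_n} -> bool.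
Variable deg : degree_map k D eps.
Hypotheses (p_prime : prime p) (char_k : p \in [pchar k]).
Hypothesis D_oriented : is_orientation k D eps.

(** From ell ^ M g = 0 follows g ^ p ell ^ M = 0, hence ell ^ (M %/ p) g = 0 with
    a smaller exponent. *)
Lemma ell_mul_eq0 m M (g : Hbar deg) : Hbar_gr deg m g -> (p * m + M <= d)%N ->
  ell deg ^+ M * g = 0 -> g = 0.
Proof.
move=> gm; elim/ltn_ind: M => M IH mM Mg0.
have [M0|M0] := posnP M; first by move: Mg0; rewrite M0 mul1r.
have Mp : (M %/ p < M)%N by rewrite ltn_Pdiv // prime_gt1.
apply: (IH _ Mp); first by apply: leq_trans mM; rewrite leq_add2l ltnW.
rewrite mulrC; apply: (Hbar_descent p_prime char_k D_oriented gm mM).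
by rewrite mulrC -(prednK (prime_gt0 p_prime)) exprS mulrA Mg0 mul0r.
Qed.

Lemma ell_mul_inj m M (g h : Hbar deg) : Hbar_gr deg m g -> Hbar_gr deg m h ->
  (p * m + M <= d)%N -> ell deg ^+ M * g = ell deg ^+ M * h -> g = h.
Proof.
move=> gm hm mM /eqP; rewrite -subr_eq0 -mulrBr => /eqP e.
by apply/eqP; rewrite -subr_eq0; apply/eqP; apply: ell_mul_eq0 mM e; apply: Hbar_grB.
Qed.

End Injectivity.

Theorem mainTheorem5 (R : realType) (p : nat) (k : fieldType) (n d : nat)
    (D : pure_complex n d) (eps : {set 'I_n} -> bool) (deg : degree_map k D eps)
    (p_prime : prime p) (char_k : p \in [pchar k])
    (D_pseudo : pseudomanifold R D)
    (D_connected : connected (realization R D))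
    (D_oriented : is_orientation k D eps) :
  [/\ (* (i) *)
      forall (m : nat) (g : Hbar deg), (p * m <= d)%N ->
        Hbar_gr deg m g -> g != 0 -> g ^+ p != 0,
      (* (ii) *)
      forall m : nat, (p * m <= d)%N ->
        forall g h : Hbar deg, Hbar_gr deg m g -> Hbar_gr deg m h ->
          ell deg ^+ (d - p * m) * g = ell deg ^+ (d - p * m) * h -> g = h,
      (* (iii) *)
      forall m : nat, (p * m + 1 <= d)%N ->
        forall g h : Hbar deg, Hbar_gr deg m g -> Hbar_gr deg m h ->
          ell deg * g = ell deg * h -> g = h &
      (* (iv) *)
      exists dim : nat -> nat,
        (forall m, has_dim (Hbar_gr deg m) (dim m)) /\
        (forall m, (m < d.-1 %/ p)%N -> (dim m <= dim m.+1)%N)].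
Proof.
have inj := ell_mul_inj (deg := deg) p_prime char_k D_oriented.
split.
- move=> m g md gm; apply: contra_neq => g0.
  have := @Hbar_descent k n d D eps deg p m 0 g p_prime char_k D_oriented gm.
  by rewrite addn0 div0n !mulr1; apply.
- by move=> m md g h gm hm; apply: inj gm hm _; rewrite subnKC.
- by move=> m md g h gm hm e; apply: inj gm hm md _; rewrite expr1.
have [dim dimE] := boolp.choice (fun m => Hbar_gr_dim deg m).
exists dim; split=> // m md.
have {}md : (p * m + 1 <= d)%N.
  have p0 := prime_gt0 p_prime.
  have : (p * m.+1 <= d.-1)%N by rewrite mulnC -leq_divRL.
  move=> le; apply: leq_trans (leq_pred d); apply: leq_trans le.
  by rewrite mulnS addnC leq_add2r.
apply: (has_dim_le (f := fun g => ell deg * g) (U := Hbar_gr deg m)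
  (U' := Hbar_gr deg m.+1)) => //.
- by move=> r b bm c; apply: Hbar_gr_lin.
- by move=> u v; rewrite mulrDr.
- by move=> c u; rewrite scalerAr.
- by move=> u um; rewrite -addn1; have := Hbar_gr_ell 1 um; rewrite expr1.
move=> u um u0; apply: (ell_mul_eq0 p_prime char_k D_oriented um md).
by rewrite expr1.
Qed.
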